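(* Let $\mathcal{X}=\mathbb{R}^p$, let $\mathcal{Y}\subset\mathbb{R}^q$ be convex and compact with diameter $D_{\mathcal{Y}}=\max_{y,y'\in\mathcal{Y}}\|y-y'\|$, let $g:\mathcal{X}\times\mathcal{Y}\to\mathbb{R}$ be $L$-smooth with $g(x,\cdot)$ concave for every $x\in\mathcal{X}$ (and $g(\cdot,y)$ possibly nonconvex), and let $f(x)=\max_{y\in\mathcal{Y}}g(x,y)$ be bounded below, $f(x)\ge f^*>-\infty$ for all $x$. Let $\varepsilon>0$. Then the algorithm Prox-DIAG (described in the context), started at $x_0$, after $$K=\left\lceil\frac{4^4L\,(f(x_0)-f^* )}{3\varepsilon^2}\right\rceil$$ steps outputs an $\varepsilon$-first order stationary point of $f$, i.e. a point $x$ with $\|\nabla f_{\frac{1}{2L}}(x)\|\le\varepsilon$. The total first-order oracle complexity (number of gradient evaluations of $g$) to output an $\varepsilon$-first order stationary point is $$O\left(\frac{L^2D_{\mathcal{Y}}\,(f(x_0)-f^* )}{\varepsilon^3}\,\log^2\frac1\varepsilon\right).$$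
   Context: Norms are Euclidean; $\mathcal{P}_{\mathcal{Y}}$ denotes Euclidean projection onto $\mathcal{Y}$. A differentiable function $g(x,y)$ is $L$-smooth if for all $(x,y),(x',y')$, $\max\{\|\nabla_x g(x,y)-\nabla_x g(x',y')\|,\|\nabla_y g(x,y)-\nabla_y g(x',y')\|\}\le L(\|x-x'\|+\|y-y'\|)$. The Fréchet subdifferential of $f$ at $x$ is $\partial f(x)=\{u: \liminf_{x'\to x}\frac{f(x')-f(x)-\langle u,x'-x\rangle}{\|x'-x\|}\ge0\}$. $f$ is $L$-weakly convex if $f(x)+\langle u_x,x'-x\rangle-\frac L2\|x'-x\|^2\le f(x')$ for all $x,x'$ and all $u_x\in\partial f(x)$. Under the hypotheses of the claim, $f=\max_{y}g(\cdot,y)$ is $L$-weakly convex. For $\lambda>0$ the Moreau envelope is $f_\lambda(x)=\min_{x'\in\mathcal{X}}f(x')+\frac1{2\lambda}\|x-x'\|^2$. A point $x$ is an $\varepsilon$-first order stationary point ($\varepsilon$-FOSP) of an $L$-weakly convex $f$ if $\|\nabla f_{\frac1{2L}}(x)\|\le\varepsilon$. Big-$O$ is asymptotic as $1/\varepsilon\to\infty$, the problem data being fixed. **Algorithm Prox-DIAG.** Input $g,L,\varepsilon,x_0,y_0$. Set $\tilde\varepsilon=\frac{\varepsilon^2}{64L}$. For $k=0,1,\dots,K$: using DIAG (below), applied to the strongly-convex–concave function $(x,y)\mapsto g(x,y)+L\|x-x_k\|^2$, find $x_{k+1}$ such that $$\max_{y\in\mathcal{Y}}g(x_{k+1},y)+L\|x_{k+1}-x_k\|^2\le\min_x\max_{y\in\mathcal{Y}}\big[g(x,y)+L\|x-x_k\|^2\big]+\frac{\tilde\varepsilon}{4};$$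 if $\max_{y\in\mathcal{Y}}g(x_k,y)-\frac{3\tilde\varepsilon}{4}\le\max_{y\in\mathcal{Y}}g(x_{k+1},y)+L\|x_{k+1}-x_k\|^2$, return $x_k$. **Algorithm DIAG** for an $L'$-smooth function $g'$ that is $\sigma$-strongly convex in $x\in\mathbb{R}^p$ and concave in $y\in\mathcal{Y}$, with starting points $x_0,y_0$, number of iterations $N$, and tolerances $\varepsilon^{(k)}_{\rm step}=\frac{L'^2D_{\mathcal{Y}}^2}{\sigma k^3(k+1)}$. Set $\beta=2L'^2/\sigma$, $z_0=y_0$. For $k=0,\dots,N-1$: $\tau_k=\frac2{k+2}$, $\eta_k=\frac{k+1}{2\beta}$, $w_k=(1-\tau_k)y_k+\tau_kz_k$; $(x_{k+1},y_{k+1})=\text{Imp-STEP}(w_k,\varepsilon^{(k+1)}_{\rm step})$; $z_{k+1}=\mathcal{P}_{\mathcal{Y}}(z_k+\eta_k\nabla_yg'(x_{k+1},w_k))$; $\bar x_{k+1}=\frac2{(k+1)(k+2)}\sum_{i=1}^{k+1}i\,x_i$. Return $(\bar x_N,y_N)$. Imp-STEP$(w,\varepsilon_{\rm step})$: set $\varepsilon_{\rm mp}=\frac{2\sigma}{5L'}\sqrt{\frac{2\varepsilon_{\rm step}}{L'}}$, $R=\lceil\log_2\frac{2D_{\mathcal{Y}}}{\varepsilon_{\rm mp}}\rceil$, $\varepsilon_{\rm agd}=\frac{\sigma\beta^2\varepsilon_{\rm mp}^2}{32L'^2}$, and (locally) $y_0=w$; for $r=0,\dots,R$, starting at $x_0$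 use Nesterov's accelerated gradient descent for the smooth strongly convex function $g'(\cdot,y_r)$ to find $\hat x_r$ with $g'(\hat x_r,y_r)\le\min_xg'(x,y_r)+\varepsilon_{\rm agd}$, and set $y_{r+1}=\mathcal{P}_{\mathcal{Y}}(w+\frac1\beta\nabla_yg'(\hat x_r,w))$; return $(\hat x_R,y_{R+1})$.
   Formalization: The complexity bound is stated for D_Y>0 and f(x_0)>f*, since otherwise the O-expression is 0 while the algorithm makes at least one gradient evaluation; existence of a run is claimed for D_Y>0, since DIAG's parameters are undefined at D_Y=0. L>0 and y_0 in Y are assumed. *)

(* Defs.v *)
(* MathComp / MathComp-Analysis *)
From HB Require Import structures.
From mathcomp Require Export all_boot all_order all_algebra.
From mathcomp Require Export all_classical all_reals all_analysis.

Set Implicit Arguments.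
Unset Strict Implicit.
Unset Printing Implicit Defensive.

Import Order.TTheory GRing.Theory Num.Theory.
Import numFieldNormedType.Exports.

Local Open Scope classical_set_scope.
Local Open Scope ring_scope.

(* Only applied to nonnegative reals. *)
Definition natceil {R : realType} (a : R) : nat := `|Num.ceil a|%N.

Section Euclidean.
Context {R : realType}.

(* The library's norm `|v| on 'rV[R]_n is the max-norm; it defines the same
   topology and the same differentiable functions. *)
Definition enorm {n} (v : 'rV[R]_n) : R := Num.sqrt (\sum_i v 0 i ^+ 2).

Definition grad {n} (F : 'rV[R]_n -> R) (x : 'rV[R]_n) : 'rV[R]_n :=
  \row_i 'D_(delta_mx 0 i) F x.

(* The default value v of xget is irrelevant when Y is nonempty, closed and
   convex. *)
Definition proj {n} (Y : set 'rV[R]_n) (v : 'rV[R]_n) : 'rV[R]_n :=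
  xget v [set u | Y u /\ forall y, Y y -> enorm (v - u) <= enorm (v - y)].

Definition diam {n} (Y : set 'rV[R]_n) : R :=
  sup [set enorm (y - y') | y in Y & y' in Y].

Definition moreau {n} (f : 'rV[R]_n -> R) (lam : R) (x : 'rV[R]_n) : R :=
  inf [set f x' + (2 * lam)^-1 * enorm (x - x') ^+ 2 | x' in setT].

(* Differentiability is required explicitly because 'D_v takes a default value
   where the limit does not exist. *)
Definition is_FOSP {n} (L : R) (f : 'rV[R]_n -> R) (eps : R)
    (x : 'rV[R]_n) : Prop :=
  differentiable (moreau f (2 * L)^-1 : 'rV[R]_n -> R^o) x /\
  enorm (grad (moreau f (2 * L)^-1) x) <= eps.

End Euclidean.

Section Algorithms.
Context {R : realType} {p q : nat}.
Implicit Types (g h : 'rV[R]_p * 'rV[R]_q -> R) (Y : set 'rV[R]_q).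

Definition gradx h (x : 'rV[R]_p) (y : 'rV[R]_q) : 'rV[R]_p :=
  grad (fun u => h (u, y)) x.

Definition grady h (x : 'rV[R]_p) (y : 'rV[R]_q) : 'rV[R]_q :=
  grad (fun v => h (x, v)) y.

(* A function on R^p x Y is given by a total function, of which only the values
   and the gradients at points of R^p x Y matter.  (By the Whitney extension
   theorem, a function on R^p x Y with Lipschitz gradient has a differentiable
   extension with the same gradients on R^p x Y.) *)
Definition smooth (L : R) Y g : Prop :=
  (forall x y, Y y -> differentiable (g : _ -> R^o) (x, y)) /\
  (forall x x' y y', Y y -> Y y' ->
     Num.max (enorm (gradx g x y - gradx g x' y'))
             (enorm (grady g x y - grady g x' y'))
       <= L * (enorm (x - x') + enorm (y - y'))).

Definition maxy h Y (x : 'rV[R]_p) : R := sup [set h (x, y) | y in Y].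

(* Number n of iterations of a method that has to produce an iterate satisfying
   P: any iterate satisfying P may be used or, if [prompt], the first one. *)
Definition stops_at (prompt : bool) (P : nat -> Prop) (n : nat) : Prop :=
  P n /\ (prompt -> forall m, (m < n)%N -> ~ P m).

(* Nesterov's accelerated gradient descent, constant-momentum scheme for an
   L-smooth s-strongly convex function with gradient G. *)
Definition agd_step (G : 'rV[R]_p -> 'rV[R]_p) (L s : R)
    (uv : 'rV[R]_p * 'rV[R]_p) : 'rV[R]_p * 'rV[R]_p :=
  let rk := Num.sqrt (L / s) in
  let u := uv.2 - L^-1 *: G uv.2 in
  (u, u + ((rk - 1) / (rk + 1)) *: (u - uv.1)).

(* The t-th iterate; it costs t evaluations of G. *)
Definition agd (G : 'rV[R]_p -> 'rV[R]_p) (L s : R) (x0 : 'rV[R]_p)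
    (t : nat) : 'rV[R]_p :=
  (iter t (agd_step G L s) (x0, x0)).1.

(* In the following relations the last argument is the number of gradient
   evaluations, a single one giving nabla_x or nabla_y at one point. *)

Definition imp_step (prompt : bool) h (L s : R) Y (x0 : 'rV[R]_p)
    (w : 'rV[R]_q) (estep : R) (out : 'rV[R]_p * 'rV[R]_q) (cost : nat) :
    Prop :=
  let beta := 2 * L ^+ 2 / s in
  let emp := 2 * s / (5 * L) * Num.sqrt (2 * estep / L) in
  let nR := natceil (ln (2 * diam Y / emp) / ln 2) in
  let eagd := s * beta ^+ 2 * emp ^+ 2 / (32 * L ^+ 2) in
  exists (xh : nat -> 'rV[R]_p) (y : nat -> 'rV[R]_q) (t : nat -> nat),
  [/\ y 0%N = w,
      forall r, (r <= nR)%N ->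
        let it := agd (fun x => gradx h x (y r)) L s x0 in
        [/\ stops_at prompt (fun n => h (it n, y r) <=
              inf [set h (x, y r) | x in setT] + eagd) (t r),
            xh r = it (t r) &
            y r.+1 = proj Y (w + beta^-1 *: grady h (xh r) w)],
      out = (xh nR, y nR.+1) &
      cost = (\sum_(r < nR.+1) (t r).+1)%N].

(* [c k] is the cost of the call to Imp-STEP in iteration k. *)
Definition diag_trace (prompt : bool) h (L s : R) Y (x0 : 'rV[R]_p)
    (y0 : 'rV[R]_q) (N : nat) (x : nat -> 'rV[R]_p) (y z : nat -> 'rV[R]_q)
    (c : nat -> nat) : Prop :=
  let beta := 2 * L ^+ 2 / s in
  let estep (k : nat) :=
    L ^+ 2 * diam Y ^+ 2 / (s * k%:R ^+ 3 * k.+1%:R) in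
  [/\ x 0%N = x0, y 0%N = y0, z 0%N = y0 &
    forall k, (k < N)%N ->
      let tau := 2 / k.+2%:R in
      let eta := k.+1%:R / (2 * beta) in
      let w := (1 - tau) *: y k + tau *: z k in
      imp_step prompt h L s Y x0 w (estep k.+1) (x k.+1, y k.+1) (c k) /\
      z k.+1 = proj Y (z k + eta *: grady h (x k.+1) w)].

Definition diag_avg (x : nat -> 'rV[R]_p) (N : nat) : 'rV[R]_p :=
  (2 / (N%:R * N.+1%:R)) *: \sum_(1 <= i < N.+1) i%:R *: x i.

(* One proximal step from xk: DIAG, started at (xk, y0), is applied to
   h := g + L |x - xk|^2, which is 3L-smooth and L-strongly convex in x, until
   the averaged iterate has the required accuracy.  An evaluation of a gradient
   of h costs one evaluation of a gradient of g. *)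
Definition prox_step (prompt : bool) g (L : R) Y (et : R) (y0 : 'rV[R]_q)
    (xk xk1 : 'rV[R]_p) (cost : nat) : Prop :=
  let h z := g z + L * enorm (z.1 - xk) ^+ 2 in
  exists (N : nat) (x : nat -> 'rV[R]_p) (y z : nat -> 'rV[R]_q)
         (c : nat -> nat),
  [/\ diag_trace prompt h (3 * L) L Y xk y0 N x y z c,
      stops_at prompt (fun n => (0 < n)%N /\
        maxy g Y (diag_avg x n) + L * enorm (diag_avg x n - xk) ^+ 2 <=
        inf [set maxy h Y u | u in setT] + et / 4) N,
      xk1 = diag_avg x N &
      cost = (\sum_(k < N) (c k).+1)%N].

(* [prox_loop _ _ _ _ _ _ n x o c]: from the current point x with n iterations
   of the loop left, the execution ends with c gradient evaluations, either
   returning x' (o = Some x') or exhausting the loop without returning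
   (o = None). *)
Inductive prox_loop (prompt : bool) g (L : R) Y (et : R) (y0 : 'rV[R]_q) :
    nat -> 'rV[R]_p -> option 'rV[R]_p -> nat -> Prop :=
| prox_exhausted x :
    prox_loop prompt g L Y et y0 0 x None 0
| prox_return n x x' c :
    prox_step prompt g L Y et y0 x x' c ->
    maxy g Y x - 3 * et / 4 <= maxy g Y x' + L * enorm (x' - x) ^+ 2 ->
    prox_loop prompt g L Y et y0 n.+1 x (Some x) c
| prox_continue n x x' c o c' :
    prox_step prompt g L Y et y0 x x' c ->
    ~ (maxy g Y x - 3 * et / 4 <= maxy g Y x' + L * enorm (x' - x) ^+ 2) ->
    prox_loop prompt g L Y et y0 n x' o c' ->
    prox_loop prompt g L Y et y0 n.+1 x o (c + c').

(* The loop runs over k = 0, ..., K. *)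
Definition prox_diag (prompt : bool) g (L : R) Y (eps : R) (x0 : 'rV[R]_p)
    (y0 : 'rV[R]_q) (K : nat) (out : option 'rV[R]_p) (cost : nat) : Prop :=
  prox_loop prompt g L Y (eps ^+ 2 / (64 * L)) y0 K.+1 x0 out cost.

End Algorithms.

(* Main.v *)
(** Write h for g + L |x - xk|^2, which is L-strongly convex and 3L-smooth in x
    and concave in y.  In an iteration of DIAG the momentum argument for concave
    maximisation goes through with gradients taken at x_{k+1}, because
    x_{k+1} almost minimises h(., y_{k+1}); it gives an accuracy
    54 L D^2 / (N (N + 1)) after N iterations.  That x_{k+1} almost minimises
    h(., y_{k+1}) holds because the update y -> y' of Imp-STEP is a contraction up
    to the error of the inner solver.  All of this is expressed through gradients
    at approximate minimisers, so that neither exact minimisers nor saddle points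
    are needed.  A returned point x_k almost attains the Moreau envelope, whose
    gradient is 2L (x_k - prox), and the strong convexity of f + L |. - x_k|^2
    bounds this distance.  For the complexity, all the x_k lie in a sublevel set of
    f, on which f >= fstar and the Lipschitz gradient give a uniform bound on the
    partial gradient of g in x, hence on the number of inner steps. *)
From HB Require Import structures.
Require Import Defs.
From mathcomp Require Import all_boot all_order all_algebra.
From mathcomp Require Import all_classical all_reals all_analysis.
From mathcomp Require Import ring lra.

Set Implicit Arguments.
Unset Strict Implicit.
Unset Printing Implicit Defensive.

Import Order.TTheory GRing.Theory Num.Theory.
Import numFieldNormedType.Exports.

Local Open Scope classical_set_scope.
Local Open Scope ring_scope.

(* all_analysis exports another proj. *)
Local Notation proj := Defs.proj.

(** The term L |x - xk|^2 does not involve y, so both mixed Lipschitz constants of h stay L although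
    h is 3L-smooth in x. A minimiser in x thus moves at most as far as y does, and an inner update,
    of step 1/beta = 1/(18 L), contracts by 1/18. Only the factor 1/2 is used: it matches the base-2
    logarithm in the number of inner rounds and leaves room for solver errors. A returned point is
    correct for every iterate that passes the accuracy test, since only the test enters; the cost
    bound is about the first passing iterate, which comes no later than the one the analysis
    provides. For a Y of diameter 0 the tolerances of DIAG vanish and a run may fail to exist, hence
    the assumption of positive diameter. The constant of the final bound is absolute: the data enter
    the inner accuracies only inside logarithms, where a small eps0 lets powers of 1/eps dominate
    them. *)

Section Dot.
Context {R : realType} {n : nat}.
Implicit Types (u v w : 'rV[R]_n) (a : R).

Definition dot u v : R := \sum_i u 0 i * v 0 i.

Lemma dotC u v : dot u v = dot v u.
Proof. by apply: eq_bigr => i _; rewrite mulrC. Qed.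

Lemma dotDl u v w : dot (u + v) w = dot u w + dot v w.
Proof. by rewrite -big_split; apply: eq_bigr => i _; rewrite mxE mulrDl. Qed.

Lemma dotZl a u v : dot (a *: u) v = a * dot u v.
Proof. by rewrite mulr_sumr; apply: eq_bigr => i _; rewrite mxE mulrA. Qed.

Lemma dotNl u v : dot (- u) v = - dot u v.
Proof. by rewrite -scaleN1r dotZl mulN1r. Qed.

Lemma dotDr u v w : dot u (v + w) = dot u v + dot u w.
Proof. by rewrite dotC dotDl !(dotC u). Qed.

Lemma dotZr a u v : dot u (a *: v) = a * dot u v.
Proof. by rewrite dotC dotZl dotC. Qed.

Lemma dotNr u v : dot u (- v) = - dot u v.
Proof. by rewrite dotC dotNl dotC. Qed.

Lemma dot0l v : dot 0 v = 0.
Proof. by rewrite -(scale0r 0) dotZl mul0r. Qed.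

Definition dotE := (dotDl, dotDr, dotNl, dotNr, dotZl, dotZr).

Lemma dot_ge0 v : 0 <= dot v v.
Proof. by apply: sumr_ge0 => i _; rewrite -expr2 sqr_ge0. Qed.

Lemma sqr_enorm v : enorm v ^+ 2 = dot v v.
Proof.
rewrite /enorm sqr_sqrtr; last by apply: sumr_ge0 => i _; rewrite sqr_ge0.
by apply: eq_bigr => i _; rewrite expr2.
Qed.

Lemma enormE v : enorm v = Num.sqrt (dot v v).
Proof. by congr Num.sqrt; apply: eq_bigr => i _; rewrite expr2. Qed.

Lemma enorm_ge0 v : 0 <= enorm v.
Proof. exact: sqrtr_ge0. Qed.

Lemma enorm_le v a : 0 <= a -> dot v v <= a ^+ 2 -> enorm v <= a.
Proof. by move=> a0; rewrite -sqr_enorm ler_sqr ?nnegrE ?enorm_ge0. Qed.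

Lemma CauchySchwarz_dot u v : dot u v <= enorm u * enorm v.
Proof.
have [v0|v0] := eqVneq (enorm v) 0.
  have vv : dot v v = 0 by rewrite -sqr_enorm v0 expr0n.
  have v_0 : v = 0.
    apply/rowP => i; rewrite mxE; apply/eqP.
    have /psumr_eq0P/(_ i isT) : \sum_i v 0 i * v 0 i = 0 by [].
    by move/(_ (fun i _ => sqr_ge0 (v 0 i)))/eqP; rewrite mulf_eq0 orbb.
  by rewrite v_0 dotC dot0l mulr_ge0 ?enorm_ge0.
rewrite (le_trans (ler_norm _))// -ler_sqr ?nnegrE ?mulr_ge0 ?enorm_ge0//.
rewrite real_normK ?num_real// exprMn !sqr_enorm.
have vv : 0 < dot v v by rewrite -sqr_enorm exprn_gt0// lt0r v0 enorm_ge0.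
have := dot_ge0 (dot v v *: u - dot u v *: v); rewrite !dotE (dotC v u) => H.
rewrite -(ler_pM2l vv); nra.
Qed.

Lemma enormN v : enorm (- v) = enorm v.
Proof. by rewrite !enormE !dotE opprK. Qed.

Lemma enormB u v : enorm (u - v) = enorm (v - u).
Proof. by rewrite -enormN opprB. Qed.

Lemma ler_enormD u v : enorm (u + v) <= enorm u + enorm v.
Proof.
apply: enorm_le; first by rewrite addr_ge0 ?enorm_ge0.
rewrite sqrrD !sqr_enorm !dotE (dotC v u).
have := CauchySchwarz_dot u v; lra.
Qed.

Lemma ler_enormB u v : enorm (u - v) <= enorm u + enorm v.
Proof. by rewrite -(enormN v) ler_enormD. Qed.

Lemma enormZ a v : 0 <= a -> enorm (a *: v) = a * enorm v.
Proof.
by move=> a0; rewrite !enormE !dotE mulrA -expr2 sqrtrM ?sqr_ge0// sqrtr_sqr ger0_norm.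
Qed.

Lemma enorm0 : enorm (0 : 'rV[R]_n) = 0.
Proof. by rewrite enormE dot0l sqrtr0. Qed.

Lemma dot_sumr (I : finType) (P : pred I) (F : I -> 'rV[R]_n) u :
  dot u (\sum_(i | P i) F i) = \sum_(i | P i) dot u (F i).
Proof.
elim/big_rec2: _ => [|i x y _ <-]; first by rewrite dotC dot0l.
by rewrite dotDr.
Qed.

Lemma dot_delta u i : dot u (delta_mx 0 i) = u 0 i.
Proof.
rewrite /dot (bigD1 i)//= mxE !eqxx mulr1 big1 ?addr0// => j ji.
by rewrite mxE (negbTE ji) andbF mulr0.
Qed.

Lemma normr_le_enorm v : `|v| <= enorm v.
Proof.
have [->|v0] := eqVneq v 0; first by rewrite normr0 enorm_ge0.
rewrite [leLHS]/Num.Def.normr /= mx_normrE; apply/bigmax_leP; split; first exact: enorm_ge0.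
move=> [i j] _ /=; rewrite (ord1 i) -ler_sqr ?nnegrE ?enorm_ge0//.
rewrite real_normK ?num_real// sqr_enorm /dot (bigD1 j)//= -expr2 lerDl.
by rewrite sumr_ge0// => k _; rewrite -expr2 sqr_ge0.
Qed.

Lemma enorm_le_normr v : enorm v <= n%:R * `|v|.
Proof.
have vi i : `|v 0 i| <= `|v|.
  by rewrite [leRHS]/Num.Def.normr /= mx_normrE; apply/bigmax_geP; right; exists (0, i).
apply: enorm_le; first by rewrite mulr_ge0.
apply: le_trans (_ : \sum_(i < n) `|v| ^+ 2 <= _).
  apply: ler_sum => i _; rewrite -expr2 -real_normK ?num_real//.
  by rewrite ler_sqr ?nnegrE.
rewrite sumr_const card_ord exprMn -[leLHS]mulr_natl ler_wpM2r ?sqr_ge0//.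
by rewrite -natrX ler_nat; case: (n) => // m; rewrite expnS leq_pmulr ?expn_gt0.
Qed.

(** Transfers Euclidean Lipschitz bounds to the topology of the library, whose balls are those of
    the max-norm. *)
Lemma locally_Lipschitz_continuous (F : 'rV[R]_n -> R) :
  (forall v, exists2 C, 0 <= C & forall w, enorm (w - v) <= 1 ->
    `|F v - F w| <= C * enorm (w - v)) -> continuous F.
Proof.
move=> FC v; have [C C0 HC] := FC v.
apply: (cvgrPdist_le (F := nbhs v) (V := R^o) F (F v)).2 => e e0.
pose d := Num.min (n.+1%:R^-1) (e / ((C + 1) * n.+1%:R)).
have d0 : 0 < d by rewrite lt_min invr_gt0 ltr0Sn divr_gt0// mulr_gt0//; lra.
apply: filterS (nbhsx_ballx v d d0) => w.
rewrite -ball_normE /= -normrN opprB => vw.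
have wv : enorm (w - v) <= n.+1%:R * d.
  apply: le_trans (enorm_le_normr _) _.
  by rewrite ler_pM// ?ler_nat// ltW.
have d1 : n.+1%:R * d <= 1.
  by rewrite -ler_pdivlMl// mulr1 ge_min lexx.
have de : (C + 1) * (n.+1%:R * d) <= e.
  have ? : 0 < (C + 1) * n.+1%:R by rewrite mulr_gt0//; lra.
  by rewrite mulrA -ler_pdivlMl// mulrC ge_min lexx orbT.
apply: le_trans (HC w (le_trans wv d1)) _.
apply: le_trans de; apply: ler_pM => //; [exact: enorm_ge0|lra].
Qed.

Lemma enorm_dist_continuous v : continuous (fun u => enorm (v - u) : R).
Proof.
apply: locally_Lipschitz_continuous => u; exists 1 => // w _.
rewrite mul1r ler_norml.
have := ler_enormD (v - w) (w - u); rewrite addrA subrK.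
have := ler_enormD (v - u) (u - w); rewrite addrA subrK (enormB u w); lra.
Qed.

End Dot.

(** * Gradients and second-order expansions *)

Section Gradient.
Context {R : realType} {n : nat}.
Implicit Types (F : 'rV[R]_n -> R) (x v d : 'rV[R]_n).

Definition dotr v : 'rV[R]_n -> R^o := dot v.

Fact dotr_is_linear v : linear (dotr v).
Proof. by move=> a u w; rewrite /dotr dotDr dotZr. Qed.

HB.instance Definition _ v :=
  GRing.isLinear.Build R 'rV[R]_n R^o *:%R (dotr v) (dotr_is_linear v).

Lemma derive_grad F x d :
  differentiable (F : 'rV[R]_n -> R^o) x -> 'D_d F x = dot (grad F x) d.
Proof.
move=> dF; rewrite (deriveE _ dF) {1}(row_sum_delta d) linear_sum dotC /dot.
by apply: eq_bigr => i _; rewrite linearZ mxE (deriveE _ dF).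
Qed.

Lemma is_derive_line F x d (t : R) :
  differentiable (F : 'rV[R]_n -> R^o) (x + t *: d) ->
  is_derive t 1 (fun s : R => F (x + s *: d) : R^o)
    (dot (grad F (x + t *: d)) d).
Proof.
move=> dF.
have E : (fun h : R => h^-1 *: (((fun s : R => F (x + s *: d) : R^o) \o shift t)
      (h *: 1) - F (x + t *: d)))
  = (fun h => h^-1 *: (((F : _ -> R^o) \o shift (x + t *: d)) (h *: d)
      - F (x + t *: d))).
  apply/funext => h /=; congr (_ *: (F _ - _)).
  by rewrite scalerDl addrCA [h *: 1]mulr1.
split; first by rewrite /derivable E; exact: diff_derivable.
by rewrite -derive_grad// /derive E.
Qed.

Lemma dotr_continuous v : continuous (dotr v).
Proof.
apply: locally_Lipschitz_continuous => x; exists (enorm v); first exact: enorm_ge0.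
move=> w _; rewrite /dotr -dotNr -dotDr ler_norml.
have := CauchySchwarz_dot v (w - x); have := CauchySchwarz_dot v (x - w).
by rewrite (enormB x) -[w - x]opprB dotNr enormN (enormB x) => ? ?; apply/andP; split; lra.
Qed.

(** A quadratic remainder is o(d), so uniqueness identifies the differential with [dot v]. The
    Moreau envelope and h get their gradients this way. *)
Lemma quadratic_grad F x v C :
  (forall d, `|F (x + d) - F x - dot v d| <= C * dot d d) ->
  differentiable (F : 'rV[R]_n -> R^o) x /\ grad F x = v.
Proof.
move=> FC.
have [C1 C10 HC1] : exists2 C1, 0 < C1 & forall d,
    `|F (x + d) - F x - dot v d| <= C1 * (`|d| * `|d|).
  exists (`|C| * n%:R ^+ 2 + 1); first by rewrite ltr_wpDl// mulr_ge0.
  move=> d; apply: le_trans (FC d) _.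
  apply: le_trans (_ : `|C| * (n%:R * `|d|) ^+ 2 <= _).
    apply: le_trans (ler_wpM2r (dot_ge0 d) (ler_norm C)) _.
    rewrite -sqr_enorm ler_wpM2l// ler_sqr ?nnegrE ?enorm_ge0 ?mulr_ge0//.
    exact: enorm_le_normr.
  by rewrite exprMn mulrA -expr2 ler_wpM2r ?sqr_ge0// lerDl.
have E : (F : _ -> R^o) \o shift x = cst (F x : R^o) + dotr v +o_ (0 : 'rV[R]_n) id.
  apply/eqaddoP => e e0; apply: filterS (nbhsx_ballx 0 (e / C1) (divr_gt0 e0 C10)) => d.
  rewrite -ball_normE /= sub0r normrN => de.
  rewrite !fctE /= [X in `|X|](_ : _ = F (x + d) - F x - dot v d).
    rewrite (le_trans (HC1 d))// mulrA ler_wpM2r//.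
    by rewrite mulrC -ler_pdivlMr// ltW.
  by rewrite -addrA -opprD [d + x]addrC.
have D : 'd (F : _ -> R^o) x = dotr v :> (_ -> _).
  exact: (diff_unique (dotr_continuous (v := v)) E).
have dF : differentiable (F : 'rV[R]_n -> R^o) x.
  by apply/diff_locallyP; rewrite D; split; [exact: dotr_continuous|].
split => //; apply/rowP => i.
by rewrite mxE (deriveE _ dF) D /dotr dot_delta.
Qed.

End Gradient.


(** * A second-order bound in one variable *)

Section Descent.
Context {R : realType}.

Lemma le_quadratic_derive (phi dphi : R -> R) (M : R) :
  (forall t : R, 0 <= t <= 1 -> is_derive t 1 (phi : R -> R^o) (dphi t)) ->
  (forall t : R, 0 <= t <= 1 -> dphi t <= dphi 0 + M * t) ->
  phi 1 <= phi 0 + dphi 0 + M / 2.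
Proof.
move=> dphiE dphiM.
(* The derivative of [psi] is at most 0 on [0, 1], so the mean value theorem gives psi 1 <= psi
   0. *)
pose psi : R -> R^o := (phi : R -> R^o) - (dphi 0 *: id + (M / 2) *: (id * id)).
have dpsi (t : R) : 0 <= t <= 1 -> is_derive t 1 psi (dphi t - (dphi 0 + M * t)).
  move=> /dphiE dt.
  have di := is_derive_id (t : R^o) (1 : R^o).
  have dq := is_deriveD (is_deriveZ (dphi 0) di) (is_deriveZ (M / 2) (is_deriveM di di)).
  have d := is_deriveB dt dq.
  apply: (@is_derive_eq _ _ _ _ _ _ _ _ d).
  by rewrite /GRing.scale /=; field.
have cpsi : {within `[0 : R, 1], continuous psi}.
  apply: derivable_within_continuous => t; rewrite in_itv /= => t01.
  by have [] := dpsi t t01.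
have dpsi' (t : R) : t \in `]0, 1[%R -> is_derive t 1 psi (dphi t - (dphi 0 + M * t)).
  by rewrite in_itv/= => /andP[t0 t1]; apply: dpsi; rewrite !ltW.
have [c] := MVT ltr01 dpsi' cpsi.
rewrite in_itv /= => /andP[c0 c1]; rewrite subr0 mulr1 => H.
have := dphiM c; rewrite (ltW c0) (ltW c1) => /(_ isT) Hc.
have : psi 1 - psi 0 <= 0 by rewrite H; lra.
rewrite /psi !fctE /= /GRing.scale /=; lra.
Qed.

End Descent.

(** * Descent inequalities and concavity *)

Section Smooth.
Local Open Scope convex_scope.
Context {R : realType}.

(** The hypotheses concern the segment alone, because g is smooth only over points of Y. The lower
    bound is the upper bound for - F. *)
Lemma descent_line n (F : 'rV[R]_n -> R) x d M :
  (forall t : R, 0 <= t <= 1 ->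
    differentiable (F : 'rV[R]_n -> R^o) (x + t *: d)) ->
  (forall t : R, 0 <= t <= 1 ->
    enorm (grad F (x + t *: d) - grad F x) <= M * (t * enorm d)) ->
  `|F (x + d) - F x - dot (grad F x) d| <= M / 2 * dot d d.
Proof.
move=> dF gF.
have dl (t : R) : 0 <= t <= 1 -> is_derive t 1 (fun s : R => F (x + s *: d) : R^o)
    (dot (grad F (x + t *: d)) d).
  by move=> t01; apply: is_derive_line; apply: dF.
have G (t : R) : 0 <= t <= 1 ->
    `|dot (grad F (x + t *: d)) d - dot (grad F (x + 0 *: d)) d|
      <= M * dot d d * t.
  move=> t01; have t0 : 0 <= t by case/andP: t01.
  rewrite scale0r addr0.
  have := CauchySchwarz_dot (grad F (x + t *: d) - grad F x) d.
  have := CauchySchwarz_dot (- (grad F (x + t *: d) - grad F x)) d.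
  rewrite dotNl enormN dotDl dotNl => h1 h2.
  have := ler_wpM2r (enorm_ge0 d) (gF t t01).
  rewrite (_ : M * (t * enorm d) * enorm d = M * dot d d * t) => [h3|].
    by rewrite ler_norml; apply/andP; split; lra.
  by rewrite -sqr_enorm; ring.
have H1 := le_quadratic_derive (M := M * dot d d) dl.
have H2 := le_quadratic_derive (phi := fun s : R => - F (x + s *: d))
  (dphi := fun t => - dot (grad F (x + t *: d)) d) (M := M * dot d d).
rewrite ler_norml; apply/andP; split.
  have := H2; rewrite !scale0r !scale1r !addr0 => {}H2.
  suff : - F (x + d) <= - F x + - dot (grad F x) d + M * dot d d / 2 by lra.
  apply: H2 => t t01; first exact: is_deriveN (dl t t01).
  by have := G t t01; rewrite scale0r addr0 ler_norml => /andP[? ?]; lra.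
have := H1; rewrite !scale0r !scale1r !addr0 => {}H1.
suff : F (x + d) <= F x + dot (grad F x) d + M * dot d d / 2 by lra.
apply: H1 => t t01.
by have := G t t01; rewrite scale0r addr0 ler_norml => /andP[? ?]; lra.
Qed.

Lemma conv_line n (y y' : convex_lmodType 'rV[R]_n) (t : {i01 R}) :
  y' <| t |> y = y + t%:num *: (y' - y : 'rV[R]_n).
Proof.
rewrite /conv /=; apply/rowP => i; rewrite !mxE /unstable.onem; ring.
Qed.

Lemma convex_set_line n (Y : set 'rV[R]_n) y y' (t : R) :
  convex_set Y -> Y y -> Y y' -> 0 <= t <= 1 -> Y (y + t *: (y' - y)).
Proof.
move=> cY Yy Yy' /andP[t0 t1].
have := cY y' y (Itv01 t0 t1) (mem_set Yy') (mem_set Yy).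
by rewrite conv_line => /set_mem.
Qed.

Variables (p q : nat) (L : R) (Y : set 'rV[R]_q)
  (g : 'rV[R]_p * 'rV[R]_q -> R).
Hypotheses (L0 : 0 < L) (cY : convex_set Y) (sg : smooth L Y g).

Lemma smooth_gradx x x' y y' : Y y -> Y y' ->
  enorm (gradx g x y - gradx g x' y') <= L * (enorm (x - x') + enorm (y - y')).
Proof. by move=> Yy Yy'; have := sg.2 x x' y y' Yy Yy'; rewrite ge_max => /andP[]. Qed.

Lemma smooth_grady x x' y y' : Y y -> Y y' ->
  enorm (grady g x y - grady g x' y') <= L * (enorm (x - x') + enorm (y - y')).
Proof. by move=> Yy Yy'; have := sg.2 x x' y y' Yy Yy'; rewrite ge_max => /andP[]. Qed.

Lemma smooth_descentx x y d : Y y ->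
  `|g (x + d, y) - g (x, y) - dot (gradx g x y) d| <= L / 2 * dot d d.
Proof.
move=> Yy; apply: (descent_line (F := fun u => g (u, y))) => t /andP[t0 t1].
  have /= := @differentiable_comp _ _ _ _ (fun u => (u, y)) (g : _ -> R^o)
    (x + t *: d); apply; last exact: sg.1.
  by apply: differentiable_pair.
apply: le_trans (smooth_gradx _ _ Yy Yy) _.
by rewrite subrr enorm0 addr0 addrAC subrr add0r enormZ.
Qed.

Lemma smooth_descenty x y y' : Y y -> Y y' ->
  `|g (x, y') - g (x, y) - dot (grady g x y) (y' - y)|
     <= L / 2 * dot (y' - y) (y' - y).
Proof.
move=> Yy Yy'.
have Yt t : 0 <= t <= 1 -> Y (y + t *: (y' - y)) by exact: convex_set_line.
have := @descent_line _ (fun v => g (x, v)) y (y' - y) L.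
rewrite [y + (y' - y)]addrC subrK; apply => t t01.
  have /= := @differentiable_comp _ _ _ _ (fun v => (x, v)) (g : _ -> R^o)
    (y + t *: (y' - y)); apply; last by apply: sg.1; exact: Yt.
  by apply: differentiable_pair.
apply: le_trans (smooth_grady _ _ (Yt t t01) Yy) _.
rewrite subrr enorm0 add0r addrAC subrr add0r enormZ//.
by case/andP: t01.
Qed.

(** Concavity at the fraction t of the segment, combined with the second-order bound there, leaves
    an error t D after division by t; then t is taken small. *)
Lemma concave_grady x y y' : convex_function Y (fun y => - g (x, y)) ->
  Y y -> Y y' -> g (x, y') <= g (x, y) + dot (grady g x y) (y' - y).
Proof.
move=> cg Yy Yy'; set a := dot _ _; set D := L / 2 * dot (y' - y) (y' - y).
have D0 : 0 <= D by rewrite mulr_ge0 ?dot_ge0// divr_ge0// ltW.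
have H t : 0 < t -> t <= 1 -> g (x, y') - g (x, y) <= a + t * D.
  move=> t0 t1; have t01 : 0 <= t <= 1 by rewrite ltW.
  have := smooth_descenty x Yy (convex_set_line cY Yy Yy' t01).
  have -> : y + t *: (y' - y) - y = t *: (y' - y) by rewrite addrAC subrr add0r.
  rewrite ler_norml !dotZr !dotZl -/a => /andP[_ h2].
  have := cg (Itv01 (proj1 (andP t01)) (proj2 (andP t01))) y' y
    (mem_set Yy') (mem_set Yy).
  rewrite convRE conv_line.
  rewrite /unstable.onem /= => h1.
  rewrite -(ler_pM2l t0).
  have : L / 2 * (t * (t * dot (y' - y) (y' - y))) = t * (t * D) by rewrite /D; ring.
  lra.
rewrite -lerBlDl; apply/ler_addgt0Pl => e e0.
have [De|De] := leP D e.
  by apply: le_trans (H 1 ltr01 (lexx _)) _; rewrite mul1r addrC lerD2r.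
have t0 : 0 < e / D by rewrite divr_gt0//; lra.
have t1 : e / D <= 1 by rewrite ler_pdivrMr ?mul1r; lra.
by apply: le_trans (H _ t0 t1) _; rewrite divfK 1?addrC//; lra.
Qed.

End Smooth.

(** * Projection onto a compact convex set *)

Section CompactConvex.
Context {R : realType} {n : nat}.
Variable Y : set 'rV[R]_n.
Hypothesis kY : compact Y.

Lemma le_diam y y' : Y y -> Y y' -> enorm (y - y') <= diam Y.
Proof.
move=> Yy Yy'; apply: ub_le_sup; last by exists y => //; exists y'.
have [M [_ /(_ (M + 1)) YM]] := compact_bounded kY.
have {}YM := YM (ltr_pwDr ltr01 (lexx M)).
exists (n%:R * ((M + 1) + (M + 1))) => _ [u Yu [u' Yu' <-]].
apply: le_trans (enorm_le_normr _) _; rewrite ler_wpM2l//.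
by rewrite (le_trans (ler_normB _ _))// lerD//; exact: YM.
Qed.

Lemma diam_ge0 y : Y y -> 0 <= diam Y.
Proof. by move=> Yy; apply: le_trans (le_diam Yy Yy); exact: enorm_ge0. Qed.

Lemma projP v y0 : Y y0 ->
  Y (proj Y v) /\ forall y, Y y -> enorm (v - proj Y v) <= enorm (v - y).
Proof.
move=> Yy0; apply: (@xgetPex _ v [set u | Y u /\ forall y, Y y -> _]).
have cv : {within Y, continuous (fun u => enorm (v - u))}.
  by apply: continuous_subspaceT; exact: enorm_dist_continuous.
have [u uY umin] := compact_EVT_min (ex_intro _ y0 Yy0) kY cv.
by exists u; split; [exact: set_mem|move=> y Yy; apply: umin; exact: mem_set].
Qed.

Hypothesis cY : convex_set Y.

(** Moving from the projection P by t (y - P) cannot bring it closer to v; a small t makes the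
    quadratic term negligible. *)
Lemma proj_obtuse v y : Y y -> dot (v - proj Y v) (y - proj Y v) <= 0.
Proof.
move=> Yy; have [YP minP] := projP v Yy; set P := proj Y v in YP minP *.
have H t : 0 < t -> t <= 1 ->
    2 * dot (v - P) (y - P) <= t * dot (y - P) (y - P).
  move=> t0 t1; have t01 : 0 <= t <= 1 by rewrite ltW.
  have := minP _ (convex_set_line cY YP Yy t01).
  rewrite -ler_sqr ?nnegrE ?enorm_ge0// !sqr_enorm opprD addrA.
  rewrite -/P; move: (v - P) (y - P) => a b; rewrite !dotE (dotC b a) => h.
  by rewrite -(ler_pM2l t0); lra.
rewrite leNgt; apply/negP => a0.
set a := dot _ _ in H a0; set b := dot _ _ in H.
have b0 : 0 <= b := dot_ge0 _.
have [ba|ba] := leP b a; first by have := H 1 ltr01 (lexx _); lra.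
have := H (a / b); rewrite divfK; last by lra.
rewrite divr_gt0//; last by lra.
rewrite ler_pdivrMr ?mul1r; last by lra.
by move=> /(_ isT (ltW ba)); lra.
Qed.

Lemma proj_nonexpansive v w y0 : Y y0 ->
  enorm (proj Y v - proj Y w) <= enorm (v - w).
Proof.
move=> Yy0; have [Yv _] := projP v Yy0; have [Yw _] := projP w Yy0.
set P := proj Y v in Yv *; set Q := proj Y w in Yw *.
have h1 : dot (v - P) (Q - P) <= 0 := proj_obtuse v Yw.
have h2 : dot (w - Q) (P - Q) <= 0 := proj_obtuse w Yv.
have h3 := CauchySchwarz_dot (v - w) (P - Q).
have h4 : dot (P - Q) (P - Q) <= dot (v - w) (P - Q).
  rewrite !dotE (dotC Q P) in h1 h2 *; lra.
rewrite -sqr_enorm in h4.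
have [->|e0] := eqVneq (enorm (P - Q)) 0; first exact: enorm_ge0.
have {}e0 : 0 < enorm (P - Q) by rewrite lt0r e0 enorm_ge0.
by rewrite -(ler_pM2r e0) -expr2; lra.
Qed.

End CompactConvex.

(** * The max-function: continuity and gradient bounds *)

Section MaxFunction.
Context {R : realType} {p q : nat}.
Variables (L : R) (Y : set 'rV[R]_q) (g : 'rV[R]_p * 'rV[R]_q -> R) (y0 : 'rV[R]_q).
Hypotheses (L0 : 0 < L) (Yy0 : Y y0) (cY : convex_set Y) (kY : compact Y)
  (sg : smooth L Y g)
  (cg : forall x, convex_function Y (fun y => - g (x, y))).

Local Notation D := (diam Y).
Local Notation f := (maxy g Y).

Lemma has_ubound_maxy x : has_ubound [set g (x, y) | y in Y].
Proof.
exists (g (x, y0) + enorm (grady g x y0) * D) => _ [y Yy <-].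
apply: le_trans (concave_grady L0 cY sg (cg x) Yy0 Yy) _; rewrite lerD2l.
apply: le_trans (CauchySchwarz_dot _ _) _.
by rewrite ler_wpM2l ?enorm_ge0// le_diam.
Qed.

Lemma le_maxy x y : Y y -> g (x, y) <= f x.
Proof. by move=> Yy; apply: ub_le_sup; [exact: has_ubound_maxy|exists y]. Qed.

Lemma maxy_le x c : (forall y, Y y -> g (x, y) <= c) -> f x <= c.
Proof. by move=> gc; apply: ge_sup; [exists (g (x, y0)), y0|move=> _ [y Yy <-]; exact: gc]. Qed.

Lemma maxyD x (c : R) : sup [set g (x, y) + c | y in Y] = f x + c.
Proof.
apply/le_anti/andP; split.
  apply: ge_sup; first by exists (g (x, y0) + c), y0.
  by move=> _ [y Yy <-]; rewrite lerD2r le_maxy.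
rewrite -lerBrDr; apply: maxy_le => y Yy; rewrite lerBrDr.
apply: ub_le_sup; last by exists y.
by exists (f x + c) => _ [z Yz <-]; rewrite lerD2r le_maxy.
Qed.

(** The partial gradient in x varies by at most L D over Y, so the one at the fixed y0 can stand in
    for the one at any y, at the price L D |d|. *)
Lemma maxy_upper x d :
  f (x + d) <= f x + dot (gradx g x y0) d + L * D * enorm d + L / 2 * dot d d.
Proof.
apply: maxy_le => y Yy.
have := smooth_descentx sg x d Yy; rewrite ler_norml => /andP[_ h1].
have := le_maxy x Yy.
have := CauchySchwarz_dot (gradx g x y - gradx g x y0) d.
have := smooth_gradx sg x x Yy Yy0; rewrite subrr enorm0 add0r => h2.
have h3 : enorm (gradx g x y - gradx g x y0) <= L * D.
  by apply: le_trans h2 _; rewrite ler_pM2l// le_diam.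
have := ler_wpM2r (enorm_ge0 d) h3.
rewrite dotDl dotNl; lra.
Qed.

Lemma maxy_lower x d :
  f x + dot (gradx g x y0) d - L * D * enorm d - L / 2 * dot d d <= f (x + d).
Proof.
suff : f x <= f (x + d) - dot (gradx g x y0) d + L * D * enorm d + L / 2 * dot d d.
  lra.
apply: maxy_le => y Yy.
have := smooth_descentx sg x d Yy; rewrite ler_norml => /andP[h1 _].
have := le_maxy (x + d) Yy.
have := CauchySchwarz_dot (gradx g x y0 - gradx g x y) d.
have := smooth_gradx sg x x Yy0 Yy; rewrite subrr enorm0 add0r => h2.
have h3 : enorm (gradx g x y0 - gradx g x y) <= L * D.
  by apply: le_trans h2 _; rewrite ler_pM2l// le_diam.
have := ler_wpM2r (enorm_ge0 d) h3.
rewrite dotDl dotNl; lra.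
Qed.

Lemma maxy_continuous : continuous f.
Proof.
apply: locally_Lipschitz_continuous => x; have D0 := diam_ge0 kY Yy0.
exists (enorm (gradx g x y0) + L * D + L / 2).
  by rewrite !addr_ge0 ?enorm_ge0 ?mulr_ge0 ?divr_ge0// ltW.
move=> w w1; have := maxy_upper x (w - x); have := maxy_lower x (w - x).
rewrite [x + (w - x)]addrC subrK.
have := CauchySchwarz_dot (gradx g x y0) (w - x).
have := CauchySchwarz_dot (gradx g x y0) (- (w - x)); rewrite dotNr enormN.
have := enorm_ge0 (w - x); rewrite -sqr_enorm.
set e := enorm (w - x) in w1 *; set a := dot _ _ => e0 h1 h2 h3 h4.
have e2 : L / 2 * e ^+ 2 <= L / 2 * e.
  by rewrite ler_pM2l ?divr_gt0// expr2 ler_piMr.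
rewrite !mulrDl ler_norml; apply/andP; split; lra.
Qed.

(** If the gradient u at y0 exceeds L D, a step along - u lowers f by at least (|u| - L D)^2 / (2
    L), and f >= fstar limits this. The second L D pays for passing from y0 to y. *)
Lemma gradx_bound fstar x y : (forall u, fstar <= f u) -> Y y ->
  enorm (gradx g x y) <= 2 * (L * D) + Num.sqrt (2 * L * (f x - fstar)).
Proof.
move=> fs Yy; have D0 := diam_ge0 kY Yy0.
have s0 : 0 <= 2 * L * (f x - fstar) by rewrite !mulr_ge0// ?subr_ge0// ltW.
suff H : enorm (gradx g x y0) <= L * D + Num.sqrt (2 * L * (f x - fstar)).
  have := smooth_gradx sg x x Yy Yy0; rewrite subrr enorm0 add0r.
  have := ler_enormD (gradx g x y - gradx g x y0) (gradx g x y0); rewrite subrK.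
  have := le_diam kY Yy Yy0; rewrite -(ler_pM2l L0); lra.
set u := gradx g x y0; set S := Num.sqrt _.
have S0 : 0 <= S := sqrtr_ge0 _.
have [//|uL] := leP (enorm u) (L * D + S).
have LD0 : 0 <= L * D by rewrite mulr_ge0// ltW.
have e0 : 0 < enorm u by lra.
(* The minimiser of the bound of [maxy_upper] along - u. *)
pose t := (enorm u - L * D) / L / enorm u.
have t0 : 0 <= t by rewrite !divr_ge0//; [lra|exact: ltW|exact: enorm_ge0].
have := maxy_upper x (- (t *: u)); rewrite enormN enormZ// -/u.
rewrite !dotNl !dotNr opprK !dotZl !dotZr -!sqr_enorm.
have := fs (x + - (t *: u)).
have te : t * enorm u = (enorm u - L * D) / L by rewrite divfK// gt_eqF.
set e := enorm u in e0 te uL *; set a := f _ => h1 h2.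
have E : (e - L * D) ^+ 2 <= 2 * L * (f x - fstar).
  have h3 : - (t * e ^+ 2) + L * D * (t * e) + L / 2 * (t * (t * e ^+ 2))
    = - (e - L * D) ^+ 2 / (2 * L).
    rewrite (_ : t * (t * e ^+ 2) = (t * e) ^+ 2); last by ring.
    rewrite (_ : t * e ^+ 2 = (t * e) * e); last by ring.
    by rewrite te; field; rewrite gt_eqF.
  have h4 : 0 <= f x - fstar - (e - L * D) ^+ 2 / (2 * L) by lra.
  have := mulr_ge0 (ltW L0) h4; rewrite mulrBr.
  rewrite (_ : L * ((e - L * D) ^+ 2 / (2 * L)) = (e - L * D) ^+ 2 / 2); first lra.
  by field; rewrite gt_eqF.
have : e - L * D <= S by rewrite -ler_sqr ?nnegrE ?sqr_sqrtr//; lra.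
lra.
Qed.

End MaxFunction.

(** * Proximal points and the Moreau envelope *)

Section Prox.
Context {R : realType} {p q : nat}.
Variables (L : R) (Y : set 'rV[R]_q) (g : 'rV[R]_p * 'rV[R]_q -> R) (y0 : 'rV[R]_q).
Hypotheses (L0 : 0 < L) (Yy0 : Y y0) (cY : convex_set Y) (kY : compact Y)
  (sg : smooth L Y g)
  (cg : forall x, convex_function Y (fun y => - g (x, y))).

Local Notation f := (maxy g Y).

Definition proxf x u := f u + L * dot (u - x) (u - x).

(** For each y, the second-order bounds at w towards u and v, weighted by t and 1 - t, cancel in the
    gradient and cost L/2 t (1 - t) |u - v|^2; the quadratic term of [proxf] gives back twice as
    much. *)
Lemma proxf_strongly_convex x u v t : 0 <= t <= 1 ->
  proxf x (v + t *: (u - v)) <=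
  (1 - t) * proxf x v + t * proxf x u - L / 2 * (t * (1 - t)) * dot (u - v) (u - v).
Proof.
move=> /andP[t0 t1]; rewrite /proxf; set w := v + t *: (u - v).
suff H y : Y y -> g (w, y) <= (1 - t) * f v + t * f u
    + L / 2 * (t * (1 - t)) * dot (u - v) (u - v).
  have := maxy_le Yy0 H.
  have -> : dot (w - x) (w - x) = (1 - t) * dot (v - x) (v - x)
      + t * dot (u - x) (u - x) - t * (1 - t) * dot (u - v) (u - v).
    have -> : w - x = (v - x) + t *: ((u - x) - (v - x)).
      by apply/rowP => i; rewrite !mxE; ring.
    have -> : u - v = (u - x) - (v - x) by apply/rowP => i; rewrite !mxE; ring.
    by move: (u - x) (v - x) => a b; rewrite !dotE (dotC b a); ring.
  lra.
move=> Yy.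
have := smooth_descentx sg w (u - w) Yy; have := smooth_descentx sg w (v - w) Yy.
rewrite ![w + (_ - w)]addrC !subrK !ler_norml => /andP[h1 _] /andP[h2 _].
have := ler_wpM2l t0 (le_maxy L0 Yy0 cY kY sg cg u Yy).
have t1' : 0 <= 1 - t by lra.
have := ler_wpM2l t1' (le_maxy L0 Yy0 cY kY sg cg v Yy).
have E1 : u - w = (1 - t) *: (u - v) by apply/rowP => i; rewrite !mxE; ring.
have E2 : v - w = - t *: (u - v) by apply/rowP => i; rewrite !mxE; ring.
move: h1 h2; rewrite E1 E2; move: (u - v) => d; rewrite !dotZl !dotZr => h1 h2 h3 h4.
have := ler_wpM2l t0 h2; have := ler_wpM2l t1' h1; lra.
Qed.

Variable fstar : R.
Hypothesis fs : forall x, fstar <= f x.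

Lemma prox_exists (x : 'rV[R]_p) : exists xh, forall u,
  proxf x xh + L / 2 * dot (u - xh) (u - xh) <= proxf x u.
Proof.
have fx0 : 0 <= (f x - fstar) / L by rewrite divr_ge0 ?subr_ge0// ltW.
(* Beyond this radius L |u - x|^2 exceeds f x - fstar, so u cannot beat x and the minimum over the
   ball is global. *)
pose r := Num.sqrt ((f x - fstar) / L).
pose A := [set u : 'rV[R]_p | enorm (x - u) <= r].
have kA : compact A.
  apply: bounded_closed_compact.
    exists (`|x| + r); split; first exact: num_real.
    move=> M Mr u Au; apply: le_trans (ltW Mr).
    rewrite -{1}(subKr x u); apply: le_trans (ler_normB _ _) _.
    by rewrite lerD2l (le_trans (normr_le_enorm _)).
  have := @closed_comp 'rV[R]_p R (fun u : 'rV[R]_p => enorm (x - u)) [set z : R | z <= r].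
  apply; last exact: closed_le.
  by move=> u _; exact: enorm_dist_continuous.
have cp : continuous (proxf x).
  have -> : proxf x = (fun u => f u + L * (enorm (x - u) * enorm (x - u)) : R).
    by apply/funext => u; rewrite /proxf -expr2 enormB sqr_enorm.
  move=> u; apply: continuousD; first exact: (maxy_continuous L0 Yy0 cY kY sg cg).
  apply: continuousM; first exact: cst_continuous.
  by apply: continuousM; exact: enorm_dist_continuous.
have Ax : A x by rewrite /A /= subrr enorm0 sqrtr_ge0.
have [xh _ xhmin] := compact_EVT_min (ex_intro _ x Ax) kA (continuous_subspaceT cp).
have {}xhmin u : proxf x xh <= proxf x u.
  have [Au|nAu] := leP (enorm (x - u)) r; first by apply: xhmin; exact: mem_set.
  apply: le_trans (xhmin x (mem_set Ax)) _.
  rewrite /proxf subrr dot0l mulr0 addr0 -sqr_enorm enormB.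
  have : r ^+ 2 < enorm (x - u) ^+ 2 by rewrite ltr_sqr ?nnegrE ?sqrtr_ge0 ?enorm_ge0.
  rewrite sqr_sqrtr// ltr_pdivrMr// => /ltW.
  by have := fs u; lra.
exists xh => u.
(* Strong convexity at xh + t (u - xh) and minimality of xh, divided by t; a small t then gives
   quadratic growth. *)
have H t : 0 < t -> t <= 1 -> L / 2 * dot (u - xh) (u - xh) - (proxf x u - proxf x xh)
    <= t * (L / 2 * dot (u - xh) (u - xh)).
  move=> t0 t1; have t01 : 0 <= t <= 1 by rewrite ltW.
  have := proxf_strongly_convex x u xh t01.
  have := xhmin (xh + t *: (u - xh)) => h1 h2.
  by rewrite -(ler_pM2l t0); lra.
set D := L / 2 * _ in H *.
have D0 : 0 <= D by rewrite mulr_ge0 ?dot_ge0// divr_ge0// ltW.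
rewrite -subr_le0; suff : D - (proxf x u - proxf x xh) <= 0 by lra.
apply/ler_addgt0Pl => e e0; rewrite addr0.
have [De|De] := leP D e.
  by apply: le_trans (H 1 ltr01 (lexx _)) _; rewrite mul1r.
have D1 : 0 < D by lra.
have t0 : 0 < e / D by rewrite divr_gt0.
have t1 : e / D <= 1 by rewrite ler_pdivrMr ?mul1r ?ltW.
by apply: le_trans (H _ t0 t1) _; rewrite divfK ?gt_eqF.
Qed.

Lemma moreau_eq x xh :
  (forall u, proxf x xh + L / 2 * dot (u - xh) (u - xh) <= proxf x u) ->
  moreau f (2 * L)^-1 x = proxf x xh.
Proof.
move=> xhP; rewrite /moreau.
have E : (2 * (2 * L)^-1)^-1 = L by field; rewrite gt_eqF.
rewrite E; have xhP' u : proxf x xh <= f u + L * enorm (x - u) ^+ 2.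
  rewrite enormB sqr_enorm; apply: le_trans (xhP u); rewrite lerDl.
  by rewrite mulr_ge0 ?dot_ge0// divr_ge0// ltW.
apply/le_anti/andP; split.
  apply: ge_inf; last by exists xh => //; rewrite enormB sqr_enorm.
  by exists (proxf x xh) => _ [u _ <-].
by apply: lb_le_inf; [exists (f x + L * enorm (x - x) ^+ 2), x|move=> _ [u _ <-]].
Qed.

(* Around x the Moreau envelope lies between two paraboloids tangent to the same
   affine map, whose slope 2L(x - xh) is given by the proximal point xh. *)
Lemma moreau_grad x xh :
  (forall u, proxf x xh + L / 2 * dot (u - xh) (u - xh) <= proxf x u) ->
  differentiable (moreau f (2 * L)^-1 : _ -> R^o) x /\
  grad (moreau f (2 * L)^-1) x = (2 * L) *: (x - xh).
Proof.
move=> xhP; apply: (@quadratic_grad _ _ _ _ _ L) => d.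
have [yh yhP] := prox_exists (x + d).
rewrite (moreau_eq xhP) (moreau_eq yhP) ler_norml.
have h1 := yhP xh; have h2 := xhP yh.
have h3 : 0 <= L / 2 * dot (xh - yh) (xh - yh).
  by rewrite mulr_ge0 ?dot_ge0// divr_ge0// ltW.
(* For the lower paraboloid, strong convexity leaves L/2 |a|^2 - 2L <a, d> with a = yh - xh, which
   this square bounds below by - 2L |d|^2. *)
have h4 := dot_ge0 ((yh - xh) - 2 *: d).
have {}h4 := mulr_ge0 (ltW L0) h4.
move: h1 h2 h3 h4; rewrite /proxf.
have -> : yh - (x + d) = (yh - xh) - (x - xh) - d by apply/rowP => i; rewrite !mxE; ring.
have -> : xh - (x + d) = - (x - xh) - d by apply/rowP => i; rewrite !mxE; ring.
have -> : yh - x = (yh - xh) - (x - xh) by apply/rowP => i; rewrite !mxE; ring.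
have -> : xh - x = - (x - xh) by apply/rowP => i; rewrite !mxE; ring.
have -> : xh - yh = - (yh - xh) by apply/rowP => i; rewrite !mxE; ring.
move: (yh - xh) (x - xh) => a b.
rewrite !dotE (dotC b a) (dotC d a) (dotC d b).
move: (dot a a) (dot a b) (dot a d) (dot b b) (dot b d) (dot d d) => aa ab ad bb bd dd.
move=> h1 h2 h3 h4; apply/andP; split; lra.
Qed.

(** The squared gradient is 4 L^2 |x - xh|^2 and quadratic growth bounds L/2 |x - xh|^2 by et; hence
    the factor 8 L. *)
Lemma is_FOSP_of_gap x eps et : 0 <= eps -> 8 * L * et <= eps ^+ 2 ->
  f x <= inf [set proxf x u | u in setT] + et -> is_FOSP L f eps x.
Proof.
move=> eps0 ete gap; have [xh xhP] := prox_exists x.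
have [dM gM] := moreau_grad xhP; split => //; rewrite gM.
apply: enorm_le => //; apply: le_trans ete.
have : inf [set proxf x u | u in setT] <= proxf x xh.
  apply: ge_inf; last by exists xh.
  exists (proxf x xh) => _ [u _ <-]; apply: le_trans (xhP u); rewrite lerDl.
  by rewrite mulr_ge0 ?dot_ge0// divr_ge0// ltW.
have := xhP x; rewrite {2}/proxf subrr dot0l mulr0 addr0 !dotZl !dotZr => h1 h2.
have : L / 2 * dot (x - xh) (x - xh) <= et by lra.
rewrite -(ler_pM2l L0); lra.
Qed.

End Prox.

(** * Linear rate of Nesterov's method *)

Section Nesterov.
Context {R : realType} {p : nat}.
Variables (F : 'rV[R]_p -> R) (G : 'rV[R]_p -> 'rV[R]_p) (M s : R).
Hypotheses (s0 : 0 < s) (sM : s <= M).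
Hypothesis Flow : forall x x' : 'rV[R]_p,
  F x + dot (G x) (x' - x) + s / 2 * dot (x' - x) (x' - x) <= F x'.
Hypothesis Fup : forall x x',
  F x' <= F x + dot (G x) (x' - x) + M / 2 * dot (x' - x) (x' - x).

Let M0 : 0 < M. Proof. exact: lt_le_trans sM. Qed.

Definition sqrt_icond := Num.sqrt (s / M).
Local Notation q := sqrt_icond.

Let q0 : (0 : R) < q. Proof. by rewrite sqrtr_gt0 divr_gt0. Qed.

Let q1 : q <= (1 : R).
Proof. by rewrite -sqrtr1 ler_wsqrtr// ler_pdivrMr// mul1r. Qed.

Let Mqq : M * q ^+ 2 = s.
Proof. by rewrite sqr_sqrtr ?divr_ge0 ?ltW// mulrC divfK// gt_eqF. Qed.

(* The usual Lyapunov function F u - F x + s/2 |z - x|^2 of the momentum method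
   at the comparison point x, where z = v + (v - u) / q and s = M q^2. *)
Definition lyapunov (x : 'rV[R]_p) (uv : 'rV[R]_p * 'rV[R]_p) : R :=
  let w := (1 + q) *: uv.2 - uv.1 - q *: x in F uv.1 - F x + M / 2 * dot w w.

(** Adds the upper bound at v for the new point to the lower bounds at v tested at u (weight 1 - q)
    and at x (weight q); nonnegative multiples of |u - v|^2 are dropped. *)
Lemma lyapunov_agd_step x uv :
  lyapunov x (agd_step G M s uv) <= (1 - q) * lyapunov x uv.
Proof.
case: uv => u v; rewrite /lyapunov /agd_step /=.
set g := G v; set u' := v - M^-1 *: g.
have th : (Num.sqrt (M / s) - 1) / (Num.sqrt (M / s) + 1) = (1 - q) / (1 + q).
  have -> : Num.sqrt (M / s) = q^-1.
    by rewrite /q -sqrtrV ?divr_ge0 ?ltW// invf_div.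
  have := q0; move: q => r r0; field; apply/andP; split; rewrite gt_eqF//. lra.
rewrite th.
have -> : (1 + q) *: (u' + (1 - q) / (1 + q) *: (u' - u)) - u' - q *: x
    = - (M^-1 *: g) - (1 - q) *: (u - v) - q *: (x - v).
  apply/rowP => i; rewrite !mxE; field; rewrite !gt_eqF//.
  by have := q0; lra.
have -> : (1 + q) *: v - u - q *: x = - (u - v) - q *: (x - v).
  by apply/rowP => i; rewrite !mxE; ring.
have h1 := Fup v u'; have h2 := Flow v u; have h3 := Flow v x.
move: h1 h2 h3; rewrite -/g.
have -> : u' - v = - (M^-1 *: g) by rewrite /u' addrAC subrr add0r.
move: (u - v) (x - v) => a b; rewrite !dotE (dotC a g) (dotC b g) (dotC b a).
have := dot_ge0 a; have := dot_ge0 b.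
move: (dot a a) (dot a b) (dot g a) (dot b b) (dot g b) (dot g g).
move=> aa ab ga bb gb gg bb0 aa0 h1 h2 h3.
have i1 : (1 - q) * (F v + ga) <= (1 - q) * F u.
  rewrite ler_wpM2l//; first by have := q1; lra.
  have : 0 <= s / 2 * aa by rewrite mulr_ge0// divr_ge0// ltW.
  lra.
have i2 : q * (F v + gb + s / 2 * bb) <= q * F x by rewrite ler_wpM2l// ltW.
have i3 : F u' <= F v - M^-1 * gg / 2.
  apply: le_trans h1 _; rewrite le_eqVlt; apply/orP; left; apply/eqP.
  by field; rewrite gt_eqF.
have i4 : 0 <= M / 2 * ((1 - q) * q * aa).
  have m0 : 0 <= M / 2 by rewrite divr_ge0// ltW.
  by rewrite mulr_ge0// mulr_ge0// mulr_ge0 ?subr_ge0 ?(ltW q0).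
rewrite -Mqq in i2.
have E : M / 2 * (- (- (M^-1 * (M^-1 * gg)) - (1 - q) * (M^-1 * ga)
   - q * (M^-1 * gb))) = M^-1 * gg / 2 + (1 - q) / 2 * ga + q / 2 * gb.
  by field; rewrite gt_eqF.
have E' z : M / 2 * (M^-1 * z) = z / 2 by field; rewrite gt_eqF.
have {}E : F u' - F x + M / 2 * (M^-1 * (M^-1 * gg) + (1 - q) ^+ 2 * aa + q ^+ 2 * bb
    + 2 * ((1 - q) * (M^-1 * ga)) + 2 * (q * (M^-1 * gb)) + 2 * ((1 - q) * (q * ab)))
   <= (1 - q) * (F u - F x + M / 2 * (aa + q ^+ 2 * bb + 2 * (q * ab))).
  have e1 : M / 2 * (M^-1 * (M^-1 * gg)) = M^-1 * gg / 2 by rewrite E'.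
  have e2 : M / 2 * ((1 - q) * (M^-1 * ga)) = (1 - q) * ga / 2.
    by rewrite mulrCA E' mulrA.
  have e3 : M / 2 * (q * (M^-1 * gb)) = q * gb / 2 by rewrite mulrCA E' mulrA.
  rewrite !mulrDr e1 [M / 2 * (2 * ((1 - q) * (M^-1 * ga)))]mulrCA e2.
  rewrite [M / 2 * (2 * (q * (M^-1 * gb)))]mulrCA e3; lra.
apply: le_trans (le_trans _ E) _; rewrite le_eqVlt; apply/orP; left; apply/eqP; ring.
Qed.

Lemma lyapunov_agd x x0 t :
  F (agd G M s x0 t) - F x <= (1 - q) ^+ t * (F x0 - F x + s / 2 * dot (x0 - x) (x0 - x)).
Proof.
have -> : F x0 - F x + s / 2 * dot (x0 - x) (x0 - x) = lyapunov x (x0, x0).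
  rewrite /lyapunov /=.
  have -> : (1 + q) *: x0 - x0 - q *: x = q *: (x0 - x).
    by apply/rowP => i; rewrite !mxE; ring.
  by rewrite dotZl dotZr -Mqq; ring.
apply: le_trans (_ : lyapunov x (iter t (agd_step G M s) (x0, x0)) <= _).
  by rewrite lerDl mulr_ge0 ?dot_ge0// divr_ge0// ltW.
elim: t => [|t IH] /=; first by rewrite expr0 mul1r.
apply: le_trans (lyapunov_agd_step _ _) _.
by rewrite exprS -mulrA ler_wpM2l// subr_ge0.
Qed.

(** Here x is any comparison point. If F x < F x0, strong convexity gives |x - x0| <= 2 |G x0| / s,
    which bounds the initial Lyapunov value; M <= 4 s gives q >= 1/2. *)
Lemma agd_rate x x0 t : M <= 4 * s ->
  F (agd G M s x0 t) <= F x + 2^-1 ^+ t * (2 * dot (G x0) (G x0) / s).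
Proof.
move=> M4s.
have t0 : 0 <= (2^-1 : R) ^+ t by rewrite exprn_ge0.
have d0 := dot_ge0 (G x0).
have e0 : 0 <= 2^-1 ^+ t * (2 * dot (G x0) (G x0) / s).
  by rewrite mulr_ge0// divr_ge0 ?mulr_ge0// ltW.
have [Fx|Fx] := leP (F x0) (F x).
  (* Compared with x0 itself, the Lyapunov function starts at 0. *)
  have := lyapunov_agd x0 x0 t; rewrite !subrr dot0l mulr0 addr0 mulr0; lra.
have q2 : 2^-1 <= q.
  rewrite -ler_sqr ?nnegrE ?(ltW q0)// -(ler_pM2l M0) Mqq; lra.
have h1 := Flow x0 x; have h2 := CauchySchwarz_dot (- G x0) (x - x0).
have h3 := CauchySchwarz_dot (G x0) (- (x - x0)).
rewrite enormN in h2 h3; rewrite dotNl in h2.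
have E : dot (x0 - x) (x0 - x) = dot (x - x0) (x - x0).
  by rewrite -opprB dotNl dotNr opprK.
have := lyapunov_agd x x0 t; rewrite E => h4.
move: h1 h2 h4; rewrite -!sqr_enorm; set e := enorm (x - x0); set n := enorm (G x0).
move=> h1 h2 h4.
have en : 0 <= e /\ 0 <= n by split; exact: enorm_ge0.
have h5 : s / 2 * e <= n.
  have [-> |ee] := eqVneq e 0; first by rewrite mulr0; case: en.
  have {}ee : 0 < e by rewrite lt0r ee; case: en.
  by rewrite -(ler_pM2r ee); nra.
have h6 : F x0 - F x + s / 2 * e ^+ 2 <= 2 * n ^+ 2 / s.
  apply: le_trans (_ : n * e <= _); first by lra.
  rewrite ler_pdivlMr//; have := ler_wpM2l (proj2 en) h5; nra.
have h7 : 0 <= F x0 - F x + s / 2 * e ^+ 2.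
  by rewrite addr_ge0 ?subr_ge0 ?(ltW Fx)// mulr_ge0 ?sqr_ge0// divr_ge0// ltW.
have h8 : (1 - q) ^+ t <= 2^-1 ^+ t.
  by rewrite lerXn2r ?nnegrE ?subr_ge0//; lra.
rewrite -lerBlDl; apply: le_trans h4 _.
apply: ler_pM => //; rewrite exprn_ge0// subr_ge0; exact: q1.
Qed.

End Nesterov.

(** * Integer ceilings and base-2 logarithms *)

Section Natceil.
Context {R : realType}.
Implicit Types a : R.

Lemma le_natceil a : a <= (natceil a)%:R.
Proof.
apply: le_trans (ceil_ge a) _; rewrite /natceil natr_absz ler_int; exact: ler_norm.
Qed.

Lemma natceil_lt a : 0 <= a -> (natceil a)%:R < a + 1.
Proof.
move=> a0; rewrite /natceil natr_absz ger0_norm ?ceil_ge0//; last first.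
  by rewrite (lt_le_trans (ltrN10 _)).
by have := gt_pred_ceil a; rewrite intrB; lra.
Qed.

Lemma ln2_gt0 : 0 < ln (2 : R).
Proof. by rewrite ln_gt0// ltr1n. Qed.

Lemma le_expn2_natceil a : 0 < a -> a <= 2 ^+ natceil (ln a / ln 2).
Proof.
move=> a0; rewrite -ler_ln ?posrE ?exprn_gt0// lnXn// -[ln 2 *+ _]mulr_natl -ler_pdivrMr ?ln2_gt0//.
exact: le_natceil.
Qed.

End Natceil.

(** * Sums and the scalar form of an accelerated step *)

Section WeightedSums.
Context {R : realType}.

Lemma sum_inv_sqr n : \sum_(i < n) (i.+1%:R ^+ 2)^-1 <= 2 :> R.
Proof.
case: n => [|n]; first by rewrite big_ord0.
suff H : \sum_(i < n.+1) (i.+1%:R ^+ 2)^-1 <= 2 - n.+1%:R^-1 :> R.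
  by apply: le_trans H _; rewrite gerBl invr_ge0.
elim: n => [|n IH]; first by rewrite big_ord_recr big_ord0 /= add0r expr1n; lra.
rewrite big_ord_recr /=; apply: le_trans (lerD IH (lexx _)) _.
have n0 : (0 : R) < n.+1%:R by [].
rewrite -[n.+2]addn1 natrD; move: (n.+1%:R : R) n0 => a a0.
have -> : 2 - (a + 1)^-1 = 2 - a^-1 + (a * (a + 1))^-1.
  by field; rewrite !gt_eqF//; lra.
have a1 : 0 < a + 1 by lra.
rewrite lerD2l lef_pV2 ?posrE; first by rewrite expr2 ler_pM2r//; lra.
  by rewrite exprn_gt0.
by rewrite mulr_gt0.
Qed.

Lemma sum_2S n : \sum_(i < n) 2 * i.+1%:R = n%:R * n.+1%:R :> R.
Proof.
elim: n => [|n IH]; first by rewrite big_ord0 mul0r.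
rewrite big_ord_recr /= IH -[n.+2]addn1 -[n.+1]addn1 !natrD; ring.
Qed.

(* The weighted sum of the inequalities of one accelerated step, with momentum
   parameter 2/(K+2) and dual step (K+1)/(36 L). *)
Lemma diag_step_scalar (K L hp hw hk hy Ga aa Gb bb Gy Gz Gyy zz d0 d1 : R) :
  0 <= K -> 0 < L -> 0 <= bb -> 0 <= aa ->
  hw + Ga - L / 2 * aa <= hp ->
  Gb - 9 * L * bb <= Ga - 9 * L * aa ->
  (K + 2) * Gb = K * Gy + 2 * Gz -> (K + 2) ^+ 2 * bb = 4 * zz ->
  hk <= hw + Gy -> hy <= hw + Gyy ->
  2 * ((K + 1) / (36 * L) * (Gyy - Gz)) <= d0 - d1 - zz ->
  K * (K + 1) * hk + 2 * (K + 1) * hy + 36 * L * d1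
    <= (K + 1) * (K + 2) * hp + 36 * L * d0.
Proof.
move=> K0 L0 bb0 aa0 h1 h2 EG Eb h3 h4 h5.
have i1 : hw + Gb - 9 * L * bb <= hp.
  have : 0 <= L * aa by exact: mulr_ge0 (ltW L0) aa0.
  lra.
have KK : 0 <= (K + 1) * (K + 2) by rewrite mulr_ge0; lra.
have := ler_wpM2l KK i1.
(* As (K + 1)(K + 2) <= (K + 2)^2, the term in bb costs at most 36 L zz, exactly what the dual
   projection supplies in [i5]. *)
have i2 : L * ((K + 1) * (K + 2) * bb) <= L * (4 * zz).
  rewrite ler_pM2l// -Eb; have : 0 <= (K + 2) * bb by rewrite mulr_ge0//; lra.
  lra.
have i3 : K * (K + 1) * hk <= K * (K + 1) * (hw + Gy).
  by rewrite ler_wpM2l// mulr_ge0//; lra.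
have i4 : 2 * (K + 1) * hy <= 2 * (K + 1) * (hw + Gyy).
  by rewrite ler_wpM2l//; lra.
have i5 : 2 * (K + 1) * (Gyy - Gz) <= 36 * L * (d0 - d1 - zz).
  have L36 : 0 < 36 * L by rewrite mulr_gt0.
  have := ler_wpM2l (ltW L36) h5.
  rewrite [leLHS](_ : _ = 2 * (K + 1) * (Gyy - Gz))//.
  by field; rewrite gt_eqF.
have e1 : (K + 1) * (K + 2) * (hw + Gb - 9 * L * bb)
  = (K + 1) * (K + 2) * hw + (K + 1) * (K * Gy + 2 * Gz)
    - 9 * (L * ((K + 1) * (K + 2) * bb)) by rewrite -EG; ring.
rewrite e1; lra.
Qed.

End WeightedSums.

(** * Imp-STEP and DIAG for a strongly-convex-concave function *)

Section ImpStep.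
Context {R : realType} {p q : nat}.
Variables (h : 'rV[R]_p * 'rV[R]_q -> R) (L : R) (Y : set 'rV[R]_q).
Hypotheses (L0 : 0 < L) (cY : convex_set Y) (kY : compact Y) (D0 : 0 < diam Y).
Hypothesis hlow : forall (x x' : 'rV[R]_p) y, Y y ->
  h (x, y) + dot (gradx h x y) (x' - x) + L / 2 * dot (x' - x) (x' - x) <= h (x', y).
Hypothesis hup : forall (x x' : 'rV[R]_p) y, Y y ->
  h (x', y) <= h (x, y) + dot (gradx h x y) (x' - x)
    + 3 * L / 2 * dot (x' - x) (x' - x).
Hypothesis hxy : forall x y y', Y y -> Y y' ->
  enorm (gradx h x y - gradx h x y') <= L * enorm (y - y').
Hypothesis hyx : forall x x' w, Y w ->
  enorm (grady h x w - grady h x' w) <= L * enorm (x - x').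
Local Notation D := (diam Y).

(** The Polyak-Lojasiewicz inequality, by completing the square in the strong convexity bound. *)
Lemma gap_le_grad x x' y : Y y ->
  h (x, y) <= h (x', y) + dot (gradx h x y) (gradx h x y) / (2 * L).
Proof.
move=> Yy; have := hlow x x' Yy; have := dot_ge0 (gradx h x y + L *: (x' - x)).
move: (gradx h x y) (x' - x) => a d; rewrite !dotE (dotC d a) => h1 h2.
move: h1 h2; move: (dot a a) (dot a d) (dot d d) => aa ad dd h1 h2.
have i0 : 0 <= (2 * L)^-1 by rewrite invr_ge0 mulr_ge0// ltW.
have {h1} := mulr_ge0 i0 h1.
rewrite [X in 0 <= X -> _](_ : _ = aa / (2 * L) + ad + L / 2 * dd); first lra.
by field; rewrite gt_eqF.
Qed.

Lemma has_lbound_slice y : Y y -> has_lbound [set h (x, y) | x in setT].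
Proof.
move=> Yy; exists (h (0, y) - dot (gradx h 0 y) (gradx h 0 y) / (2 * L)) => _ [x _ <-].
by have := gap_le_grad 0 x Yy; lra.
Qed.

Lemma inf_slice_le x y : Y y -> inf [set h (x, y) | x in setT] <= h (x, y).
Proof. by move=> Yy; apply: ge_inf; [exact: has_lbound_slice|exists x]. Qed.

Lemma le_inf_slice c y : (forall x, c <= h (x, y)) -> c <= inf [set h (x, y) | x in setT].
Proof. by move=> hc; apply: lb_le_inf; [exists (h (0, y)), 0|move=> _ [x _ <-]]. Qed.

(** A gradient step of length 1/(3L) lowers h by at least |grad|^2 / (6 L), yet cannot get more than
    e below h(x, y). *)
Lemma approx_min_grad x y e : Y y -> h (x, y) <= inf [set h (x, y) | x in setT] + e ->
  dot (gradx h x y) (gradx h x y) <= 6 * L * e.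
Proof.
move=> Yy hx; have := hup x (x - (3 * L)^-1 *: gradx h x y) Yy.
have := inf_slice_le (x - (3 * L)^-1 *: gradx h x y) Yy.
have -> : x - (3 * L)^-1 *: gradx h x y - x = - ((3 * L)^-1 *: gradx h x y).
  by rewrite addrAC subrr add0r.
move: (gradx h x y) => a; rewrite !dotE => h1 h2.
have E : - ((3 * L)^-1 * dot a a) + 3 * L / 2 * ((3 * L)^-1 * ((3 * L)^-1 * dot a a))
  = - (dot a a / (6 * L)) by field; rewrite gt_eqF.
have : dot a a / (6 * L) <= e by lra.
by rewrite ler_pdivrMr ?mulr_gt0//; lra.
Qed.

Lemma strong_monotone x x' y : Y y ->
  L * enorm (x - x') <= enorm (gradx h x y - gradx h x' y).
Proof.
move=> Yy; have := hlow x x' Yy; have := hlow x' x Yy.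
have := CauchySchwarz_dot (gradx h x y - gradx h x' y) (x - x').
have := enorm_ge0 (gradx h x y - gradx h x' y).
have [-> ? _ _ _|e0] := eqVneq (enorm (x - x')) 0; first by rewrite mulr0.
have {}e0 : 0 < enorm (x - x') by rewrite lt0r e0 enorm_ge0.
rewrite -[x' - x]opprB !dotNl !dotNr opprK dotDl dotNl -sqr_enorm => h0 h1 h2 h3.
rewrite -(ler_pM2r e0) -mulrA -expr2; lra.
Qed.

(* [emp_of], [eagd_of] and [nR_of] are the quantities emp, eagd and nR computed
   by imp_step at estep = e, smoothness 3L and strong convexity L. *)
Definition emp_of (e : R) := 2 * L / (5 * (3 * L)) * Num.sqrt (2 * e / (3 * L)).

Lemma emp_of_gt0 e : 0 < e -> 0 < emp_of e.
Proof.
move=> e0; apply: mulr_gt0; last rewrite sqrtr_gt0; apply: divr_gt0;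
  do ?[apply: mulr_gt0 | done].
Qed.

Lemma emp_of_sqr e : 0 < e -> 675 * L * emp_of e ^+ 2 = 8 * e.
Proof.
move=> e0; rewrite exprMn sqr_sqrtr; last first.
  by rewrite divr_ge0// mulr_ge0// ltW.
by field; rewrite gt_eqF.
Qed.

Definition eagd_of (e : R) :=
  L * (2 * (3 * L) ^+ 2 / L) ^+ 2 * emp_of e ^+ 2 / (32 * (3 * L) ^+ 2).

Lemma eagd_ofE e : eagd_of e = 9 / 8 * L * emp_of e ^+ 2.
Proof. by rewrite /eagd_of; field; rewrite gt_eqF. Qed.

Lemma eagd_of_gt0 e : 0 < e -> 0 < eagd_of e.
Proof.
move=> e0; rewrite eagd_ofE; apply: mulr_gt0; last by rewrite exprn_gt0// emp_of_gt0.
by rewrite mulr_gt0.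
Qed.

Definition nR_of (e : R) := natceil (ln (2 * D / emp_of e) / ln 2).

Local Notation itn x0 y := (agd (fun x => gradx h x y) (3 * L) L x0).
Local Notation beta := (2 * (3 * L) ^+ 2 / L).

Lemma betaE : beta = 18 * L.
Proof. by field; rewrite gt_eqF. Qed.

(** The last inner step is at most of size em, so the gradient at the final x, small at y_R by the
    solver accuracy, stays small at y_{R+1}; [gap_le_grad] turns it into a gap in value. *)
Lemma imp_step_spec b x0 w e out c : 0 < e -> Y w ->
  imp_step b h (3 * L) L Y x0 w e out c ->
  [/\ Y out.2, out.2 = proj Y (w + (18 * L)^-1 *: grady h out.1 w) &
    forall x, h out <= h (x, out.2) + e].
Proof.
move=> e0 Yw [xh [y [t [y0w]]]]; rewrite -/(emp_of e) -/(nR_of e) -/(eagd_of e) betaE.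
move=> + -> _ /=; have em0 := emp_of_gt0 e0; have emE := emp_of_sqr e0.
have Dem : 0 < 2 * D / emp_of e by apply: divr_gt0 => //; exact: mulr_gt0.
rewrite eagd_ofE; have := le_expn2_natceil Dem; rewrite -/(nR_of e).
move: (nR_of e) (emp_of e) em0 emE {Dem} => n em em0 emE nE H.
have Lem0 : 0 < L * em by rewrite mulr_gt0.
have Yy r : (r <= n.+1)%N -> Y (y r).
  case: r => [_|r rn]; first by rewrite y0w.
  by have [_ _ ->] := H r rn; have [] := projP kY (w + (18 * L)^-1 *: grady h (xh r) w) Yw.
(* With eagd = 9/8 L em^2, [approx_min_grad] yields 27/4 (L em)^2, and 27/4 is just below
   (13/5)^2. *)
have G r : (r <= n)%N -> enorm (gradx h (xh r) (y r)) <= 13 / 5 * (L * em).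
  move=> rn; have [[Hr _] xhr _] := H r rn.
  apply: enorm_le; first by lra.
  rewrite xhr; apply: le_trans (approx_min_grad (Yy r (leqW rn)) Hr) _.
  have := sqr_ge0 (L * em); lra.
have L18 : 0 <= (18 * L)^-1 by rewrite invr_ge0 mulr_ge0// ltW.
(* With X = D / 2^r, 18 L times the new step is at most L X + (1/3 + 26/5) L em, while the bound to
   reach becomes 9 L X + 6 L em. *)
have step r : (r <= n)%N -> enorm (y r.+1 - y r) <= D / 2 ^+ r + 3^-1 * em.
  elim: r => [_|r IH rn].
    rewrite expr0 divr1 (le_trans (le_diam kY (Yy 1%N _) (Yy 0%N _)))//.
    by rewrite lerDl; lra.
  have {}IH := IH (ltnW rn).
  have [_ _ ->] := H r.+1 rn; have [_ _ E] := H r (ltnW rn); rewrite E.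
  apply: le_trans (proj_nonexpansive kY cY _ _ Yw) _.
  rewrite opprD addrACA subrr add0r -scalerBr enormZ//.
  have h1 := hyx (xh r.+1) (xh r) Yw.
  have Yr := Yy r (leqW (ltnW rn)); have Yr1 := Yy r.+1 (leqW rn).
  have h2 := strong_monotone (xh r.+1) (xh r) Yr1.
  have h3 := hxy (xh r) Yr1 Yr.
  have h4 := ler_enormB (gradx h (xh r.+1) (y r.+1)) (gradx h (xh r) (y r.+1)).
  have h5 := ler_enormD (gradx h (xh r) (y r.+1) - gradx h (xh r) (y r)) (gradx h (xh r) (y r)).
  rewrite subrK in h5.
  have h6 := G r.+1 rn; have h7 := G r (ltnW rn).
  have h8 : L * enorm (y r.+1 - y r) <= L * (D / 2 ^+ r + 3^-1 * em).
    by rewrite ler_pM2l.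
  have h9 : enorm (grady h (xh r.+1) w - grady h (xh r) w)
      <= 28 / 5 * (L * em) + L * (D / 2 ^+ r).
    by apply: le_trans h1 _; apply: le_trans h2 _; apply: le_trans h4 _; lra.
  have X0 : 0 <= L * (D / 2 ^+ r).
    by rewrite mulr_ge0// ?divr_ge0 ?exprn_ge0// ltW.
  rewrite ler_pdivrMl; last by rewrite mulr_gt0.
  apply: le_trans h9 _; rewrite exprS invfM [D * (2^-1 * _)]mulrCA.
  move: (D / 2 ^+ r) X0 => X X0.
  rewrite [leRHS](_ : _ = 9 * (L * X) + 6 * (L * em)); last by field.
  rewrite addrC lerD ?ler_peMl ?ler1n// ler_wpM2r ?(ltW Lem0)//.
  by rewrite ler_pdivrMr// -natrM ler_nat.
have Yn := Yy n (leqnSn n); have Yn1 := Yy n.+1 (leqnn _).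
split => //; first by have [_ _ ->] := H n (leqnn n).
move=> x; apply: le_trans (gap_le_grad _ x Yn1) _; rewrite lerD2l.
have s1 := step n (leqnn n).
have s2 : D / 2 ^+ n <= em / 2.
  rewrite ler_pdivrMr ?exprn_gt0// -(@ler_pM2l _ 2)//.
  move: nE; rewrite ler_pdivrMr// => /le_trans; apply.
  by rewrite mulrA [2 * (_ / 2)]mulrC divfK// mulrC.
have s3 : enorm (gradx h (xh n) (y n.+1)) <= 7 / 2 * (L * em).
  have h3 := hxy (xh n) Yn1 Yn.
  have h5 := ler_enormD (gradx h (xh n) (y n.+1) - gradx h (xh n) (y n)) (gradx h (xh n) (y n)).
  rewrite subrK in h5; have := G n (leqnn n).
  have : L * enorm (y n.+1 - y n) <= L * (5 / 6 * em) by rewrite ler_pM2l//; lra.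
  lra.
have s4 : dot (gradx h (xh n) (y n.+1)) (gradx h (xh n) (y n.+1)) <= 13 * (L * em) ^+ 2.
  rewrite -sqr_enorm; apply: le_trans (_ : (7 / 2 * (L * em)) ^+ 2 <= _).
    by rewrite ler_sqr ?nnegrE ?enorm_ge0// mulr_ge0 ?(ltW Lem0).
  by have := sqr_ge0 (L * em); rewrite exprMn; lra.
rewrite ler_pdivrMr ?mulr_gt0//; apply: le_trans s4 _.
have E : 13 * (L * em) ^+ 2 = L * (104 / 675 * e).
  rewrite (_ : 13 * _ = L * (13 / 675) * (675 * L * em ^+ 2)); last by field.
  by rewrite emE; field.
by rewrite E; have := mulr_gt0 L0 e0; lra.
Qed.

Variables (x0 : 'rV[R]_p) (B : R).
Hypothesis hB : forall y, Y y -> enorm (gradx h x0 y) <= B.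

Local Notation accurate y e :=
  (fun n : nat => h (itn x0 y n, y) <= inf [set h (x, y) | x in setT] + eagd_of e).

Lemma agd_accurate y e t : Y y -> 2 * B ^+ 2 / L <= eagd_of e * 2 ^+ t ->
  accurate y e t.
Proof.
move=> Yy Ht; rewrite /= -lerBlDr; apply: le_inf_slice => x; rewrite lerBlDr.
have L3 : L <= 3 * L by rewrite ler_peMl ?ler1n// ltW.
have L4 : 3 * L <= 4 * L by rewrite ler_pM2r// ler_nat.
have H := agd_rate L0 L3 (fun x x' => hlow x x' Yy) (fun x x' => hup x x' Yy) x x0 t L4.
apply: le_trans H _.
rewrite lerD2l exprVn mulrC ler_pdivrMr ?exprn_gt0//; apply: le_trans Ht.
rewrite ler_pM2r ?invr_gt0// ler_pM2l// -sqr_enorm ler_sqr ?nnegrE ?enorm_ge0 ?hB//.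
exact: le_trans (enorm_ge0 _) (hB Yy).
Qed.

Lemma stops_at_exists (P : nat -> Prop) : (exists n, P n) -> exists n, stops_at true P n.
Proof.
move=> [n Pn]; have exP : exists n, `[< P n >] by exists n; apply/asboolP.
case: (ex_minnP exP) => m /asboolP Pm mmin; exists m; split => // _ k km Pk.
by have := mmin k; rewrite leqNgt km; move/asboolP : Pk => /[swap] /[apply].
Qed.

Lemma stops_at_le (P : nat -> Prop) n m : stops_at true P n -> P m -> (n <= m)%N.
Proof. by move=> [_ H] Pm; rewrite leqNgt; apply/negP => /(H isT). Qed.

Lemma imp_step_exists w e : 0 < e -> Y w ->
  exists out c, imp_step true h (3 * L) L Y x0 w e out c.
Proof.
move=> e0 Yw.
have /choice[tt Htt] : forall y, exists t, Y y -> stops_at true (accurate y e) t.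
  move=> y; have [Yy|nY] := pselect (Y y); last by exists 0%N.
  have [|t Ht] := @stops_at_exists (accurate y e); last by exists t.
  pose a := 2 * B ^+ 2 / L / eagd_of e + 1.
  have a0 : 0 < a.
    by rewrite ltr_wpDl// divr_ge0 ?(ltW (eagd_of_gt0 e0))// divr_ge0 ?(ltW L0)// mulr_ge0// sqr_ge0.
  exists (natceil (ln a / ln 2)); apply: agd_accurate => //.
  rewrite [leRHS]mulrC -ler_pdivrMr ?eagd_of_gt0//; apply: le_trans (_ : a <= _); first by rewrite /a lerDl.
  exact: le_expn2_natceil.
pose xx y := itn x0 y (tt y).
pose y := fix y r := if r is r'.+1 then proj Y (w + beta^-1 *: grady h (xx (y r')) w) else w.
have Yy r : Y (y r).
  by case: r => [|r] //=; have [] := projP kY (w + beta^-1 *: grady h (xx (y r)) w) Yw.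
exists (xx (y (nR_of e)), y (nR_of e).+1), (\sum_(r < (nR_of e).+1) (tt (y r)).+1)%N.
exists (fun r => xx (y r)), y, (fun r => tt (y r)); split => // r _; split => //.
exact: Htt.
Qed.

Lemma imp_step_cost w e out c T : Y w ->
  imp_step true h (3 * L) L Y x0 w e out c -> 2 * B ^+ 2 / L <= eagd_of e * 2 ^+ T ->
  (c <= (nR_of e).+1 * T.+1)%N.
Proof.
move=> Yw [xh [y [t [y0w]]]]; rewrite -/(emp_of e) -/(nR_of e) -/(eagd_of e) => H _ -> HT.
have Yy r : (r <= (nR_of e).+1)%N -> Y (y r).
  case: r => [_|r rn]; first by rewrite y0w.
  by have [_ _ ->] := H r rn; have [] := projP kY (w + beta^-1 *: grady h (xh r) w) Yw.
rewrite -[X in (_ <= X * _)%N]card_ord -sum_nat_const; apply: leq_sum => -[r rn] _ /=.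
have [Hr _ _] := H r rn; rewrite ltnS; apply: stops_at_le Hr _.
by apply: agd_accurate => //; apply: Yy; exact: leqW.
Qed.

Hypothesis hconc : forall x y y', Y y -> Y y' ->
  h (x, y') <= h (x, y) + dot (grady h x y) (y' - y).
Hypothesis hylow : forall x y y', Y y -> Y y' ->
  h (x, y) + dot (grady h x y) (y' - y) - L / 2 * dot (y' - y) (y' - y) <= h (x, y').

Local Notation tau k := (2 / (k%N).+2%:R : R).
Local Notation eta k := ((k%N).+1%:R / (2 * beta) : R).
Local Notation mix k y z := ((1 - tau k) *: y + tau k *: z).
Local Notation estep k :=
  ((3 * L) ^+ 2 * D ^+ 2 / (L * (k%N)%:R ^+ 3 * (k%N).+1%:R) : R).

Lemma estep_gt0 k : 0 < estep k.+1.
Proof.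
apply: divr_gt0; apply: mulr_gt0 => //; first by rewrite exprn_gt0// mulr_gt0.
  by rewrite exprn_gt0.
by rewrite mulr_gt0// exprn_gt0.
Qed.

Lemma mix_mem k y z : Y y -> Y z -> Y (mix k y z).
Proof.
move=> Yy Yz; have -> : mix k y z = y + tau k *: (z - y).
  by apply/rowP => i; rewrite !mxE; ring.
apply: convex_set_line => //; rewrite divr_ge0//=.
by rewrite ler_pdivrMr// mul1r ler_nat.
Qed.

(** Both projections use the gradient at x1. The one for y1 is tested at the mixture of yk and z1,
    which differs from w by tau (z1 - zk); this ties it to the one for z1. *)
Lemma diag_step k x1 y1 yk zk z1 y : Y yk -> Y zk -> Y y ->
  let w := mix k yk zk in
  y1 = proj Y (w + (18 * L)^-1 *: grady h x1 w) ->
  z1 = proj Y (zk + eta k *: grady h x1 w) ->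
  k%:R * k.+1%:R * h (x1, yk) + 2 * k.+1%:R * h (x1, y)
    + 36 * L * dot (y - z1) (y - z1)
  <= k.+1%:R * k.+2%:R * h (x1, y1) + 36 * L * dot (y - zk) (y - zk).
Proof.
move=> Yyk Yzk Yy w y1E z1E.
have Yw : Y w by exact: mix_mem.
have [Yy1 _] := projP kY (w + (18 * L)^-1 *: grady h x1 w) Yw.
have [Yz1 _] := projP kY (zk + eta k *: grady h x1 w) Yw.
rewrite -y1E in Yy1; rewrite -z1E in Yz1.
have h1 := hylow x1 Yw Yy1.
have h3 := hconc x1 Yw Yyk; have h4 := hconc x1 Yw Yy.
have Yv : Y (mix k yk z1) by exact: mix_mem.
have h2 := proj_obtuse kY cY (w + (18 * L)^-1 *: grady h x1 w) Yv.
have h5 := proj_obtuse kY cY (zk + eta k *: grady h x1 w) Yy.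
rewrite -y1E in h2; rewrite -z1E in h5; move: h1 h2 h3 h4 h5.
set G := grady h x1 w.
have K2 : k.+2%:R = k%:R + 2 :> R by rewrite -addn2 natrD.
have K1 : k.+1%:R = k%:R + 1 :> R by rewrite -addn1 natrD.
have k0 : 0 <= k%:R :> R by [].
have bE : mix k yk z1 - w = tau k *: (z1 - zk).
  by rewrite /w; apply/rowP => i; rewrite !mxE; ring.
have bE' : (k%:R + 2) *: (mix k yk z1 - w) = k%:R *: (yk - w) + 2 *: (z1 - w).
  rewrite /w K2; apply/rowP => i; rewrite !mxE; field.
  by rewrite gt_eqF//; lra.
have -> : w + (18 * L)^-1 *: G - y1 = (18 * L)^-1 *: G - (y1 - w).
  by rewrite addrAC opprB addrC addrA.
have -> : mix k yk z1 - y1 = (mix k yk z1 - w) - (y1 - w).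
  by rewrite opprB addrA subrK.
have -> : zk + eta k *: G - z1 = eta k *: G - (z1 - zk).
  by rewrite addrAC opprB addrC addrA.
have bb : (k%:R + 2) ^+ 2 * dot (mix k yk z1 - w) (mix k yk z1 - w)
    = 4 * dot (z1 - zk) (z1 - zk).
  rewrite bE dotZl dotZr K2; move: (dot _ _) => u; field.
  by rewrite gt_eqF//; lra.
have Gb : (k%:R + 2) * dot G (mix k yk z1 - w) = k%:R * dot G (yk - w) + 2 * dot G (z1 - w).
  by rewrite -[LHS]dotZr bE' [LHS]dotDr; congr (_ + _); exact: dotZr.
move: bb Gb (dot_ge0 (mix k yk z1 - w)) (dot_ge0 (y1 - w)); move: (mix k yk z1 - w) (y1 - w) => b a.
move=> bb Gb bb0 aa0 h1 h2 h3 h4 h5.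
rewrite K2 K1; apply: (diag_step_scalar k0 L0 bb0 aa0 h1 _ Gb bb h3 h4).
  have L18 : 0 < 18 * L by rewrite mulr_gt0.
  have {}h2 := ler_wpM2l (ltW L18) h2; move: h2.
  rewrite !dotE mulr0 (dotC a b) [leLHS](_ : _ =
    dot G b - dot G a - 18 * L * (dot b a - dot a a)); last first.
    by field; rewrite gt_eqF.
  have := mulr_ge0 (ltW L18) (dot_ge0 (b - a)); rewrite !dotE (dotC a b).
  move: (dot b b) (dot b a) (dot a a) (dot G a) (dot G b) => u1 u2 u3 u4 u5 i1 i2.
  lra.
rewrite betaE (_ : 2 * (18 * L) = 36 * L) in h5; last by ring.
move: h5; rewrite K1.
have -> : y - w = (y - z1) + (z1 - w) by rewrite addrA subrK.
have -> : y - zk = (y - z1) + (z1 - zk) by rewrite addrA subrK.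
move: (y - z1) (z1 - zk) (z1 - w) => u v s; rewrite !dotE (dotC v u).
lra.
Qed.

Section Trace.
Variables (b : bool) (z0 : 'rV[R]_q) (N : nat) (x : nat -> 'rV[R]_p)
  (y z : nat -> 'rV[R]_q) (c : nat -> nat).
Hypotheses (Yz0 : Y z0) (tr : diag_trace b h (3 * L) L Y x0 z0 N x y z c).

Lemma diag_trace_mem k : (k <= N)%N -> Y (y k) /\ Y (z k).
Proof.
have [_ y0E z0E H] := tr.
elim: k => [|k IH] kN; first by rewrite y0E z0E.
have [Yy Yz] := IH (ltnW kN); have [Himp ->] := H k kN.
have Yw : Y (mix k (y k) (z k)) by exact: mix_mem.
have [? _ _] := imp_step_spec (estep_gt0 k) Yw Himp; split => //.
have [//] := projP kY (z k + eta k *: grady h (x k.+1) (mix k (y k) (z k))) Yw.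
Qed.

(** The quantity n (n + 1) inf_u h(u, y_n) telescopes: in [diag_step], h(x_{n+1}, y_n) is at least
    the old infimum and h(x_{n+1}, y_{n+1}) at most the new one plus the tolerance. *)
Lemma diag_potential n v : (n <= N)%N -> Y v ->
  \sum_(i < n) 2 * i.+1%:R * h (x i.+1, v) + 36 * L * dot (v - z n) (v - z n)
  <= n%:R * n.+1%:R * inf [set h (u, y n) | u in setT]
     + 36 * L * dot (v - z0) (v - z0)
     + \sum_(i < n) 9 * L * D ^+ 2 * (i.+1%:R ^+ 2)^-1.
Proof.
move=> + Yv; have [_ y0E z0E H] := tr.
elim: n => [|n IH] nN; first by rewrite !big_ord0 z0E -[0%:R]/(0 : R) !mul0r addr0.
have {}IH := IH (ltnW nN); rewrite !big_ord_recr /=.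
have [Yy Yz] := diag_trace_mem (ltnW nN); have [Yy1 Yz1] := diag_trace_mem nN.
have [Himp zE] := H n nN; have Yw : Y (mix n (y n) (z n)) by exact: mix_mem.
have [_ yE Hacc] := imp_step_spec (estep_gt0 n) Yw Himp; rewrite /= in yE Hacc.
have S := diag_step Yy Yz Yv yE zE.
have i1 := ler_wpM2l (mulr_ge0 (ler0n R n) (ler0n R n.+1)) (inf_slice_le (x n.+1) Yy).
have i2 : h (x n.+1, y n.+1) - estep n.+1 <= inf [set h (u, y n.+1) | u in setT].
  by apply: le_inf_slice => u; rewrite lerBlDr; exact: Hacc.
have {}i2 := ler_wpM2l (mulr_ge0 (ler0n R n.+1) (ler0n R n.+2)) i2.
(* This explains the form of the tolerance: weighted by (n + 1)(n + 2) it is summable. *)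
have e1 : n.+1%:R * n.+2%:R * estep n.+1 = 9 * L * D ^+ 2 * (n.+1%:R ^+ 2)^-1.
  have : (n.+1%:R : R) != 0 by []. have : (n.+2%:R : R) != 0 by [].
  move: (n.+1%:R : R) (n.+2%:R : R) => r1 r2 r20 r10.
  by field; rewrite ?r10 ?r20 ?(gt_eqF L0).
rewrite mulrBr e1 in i2.
move: IH S i1 i2; move: (inf _) (inf _) (\sum_(i < n) _) (\sum_(i < n) _) => I1 I2 S1 S2.
move: (dot _ _) (dot _ _) (dot _ _) (h _) (h _) (h _) => d1 d2 d3 u1 u2 u3.
move: (9 * L * D ^+ 2 * _) (n.+1%:R * n.+2%:R) (n%:R * n.+1%:R) (2 * n.+1%:R) => f1 f2 f3 f4.
lra.
Qed.

(** Jensen's inequality, through the tangent at the average: the weighted deviations from it sum to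
    0. *)
Lemma diag_avg_le n v : Y v -> (0 < n)%N ->
  n%:R * n.+1%:R * h (diag_avg x n, v) <= \sum_(i < n) 2 * i.+1%:R * h (x i.+1, v).
Proof.
move=> Yv n0; rewrite -sum_2S mulr_suml -subr_ge0 -sumrB.
set a := diag_avg x n; set G := gradx h a v.
apply: le_trans (_ : \sum_(i < n) 2 * i.+1%:R * dot G (x i.+1 - a) <= _).
  have S0 : \sum_(i < n) (2 * i.+1%:R) *: (x i.+1 - a) = 0.
    under eq_bigr do rewrite scalerBr -scalerA.
    rewrite sumrB -scaler_suml sum_2S -scaler_sumr {1}/a /diag_avg.
    rewrite big_add1 big_mkord /= scalerA mulrCA divff; last first.
      by rewrite mulf_neq0// pnatr_eq0 -lt0n.
    by rewrite mulr1 subrr.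
  have := dot_sumr xpredT (fun i : 'I_n => (2 * i.+1%:R) *: (x i.+1 - a)) G.
  rewrite S0 dotC dot0l => {1}->; rewrite le_eqVlt; apply/orP; left; apply/eqP.
  by apply: eq_bigr => i _; rewrite dotZr.
apply: ler_sum => i _; rewrite -mulrBr ler_wpM2l// ?mulr_ge0//.
have := hlow a (x i.+1) Yv; have := dot_ge0 (x i.+1 - a).
move=> d0; have : 0 <= L / 2 * dot (x i.+1 - a) (x i.+1 - a).
  by rewrite mulr_ge0// divr_ge0// ltW.
by rewrite -/G; lra.
Qed.

(** The constant 54 is 36 from the initial distance plus 9 times 2 from the tolerances. *)
Lemma diag_gap n : (0 < n <= N)%N -> exists2 v, Y v & forall u y',
  Y y' -> h (diag_avg x n, y') <= h (u, v) + 54 * L * D ^+ 2 / (n%:R * n.+1%:R).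
Proof.
move=> /andP[n0 nN]; have [Yy _] := diag_trace_mem nN.
exists (y n) => // u y' Yy'.
have n00 : (0 : R) < n%:R * n.+1%:R by rewrite mulr_gt0 ?ltr0n.
rewrite -(ler_pM2l n00) mulrDr [n%:R * _ * (_ / _)]mulrCA divff ?gt_eqF// mulr1.
have h1 := diag_potential nN Yy'; have h2 := diag_avg_le Yy' n0.
have h3 := ler_wpM2l (ltW n00) (inf_slice_le u Yy).
have h4 : 36 * L * dot (y' - z0) (y' - z0) <= 36 * L * D ^+ 2.
  rewrite ler_pM2l ?mulr_gt0// -sqr_enorm ler_sqr ?nnegrE ?enorm_ge0 ?le_diam//.
  exact: ltW.
have h5 : 0 <= 36 * L * dot (y' - z n) (y' - z n).
  by rewrite mulr_ge0 ?dot_ge0// mulr_ge0// ltW.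
have h6 : \sum_(i < n) 9 * L * D ^+ 2 * (i.+1%:R ^+ 2)^-1 <= 9 * L * D ^+ 2 * 2.
  rewrite -mulr_sumr ler_wpM2l ?sum_inv_sqr// mulr_ge0 ?sqr_ge0//.
  by rewrite mulr_ge0// ltW.
apply: le_trans h2 _.
move: h1 h3 h4 h5 h6; move: (inf _) (\sum_(i < n) _) (\sum_(i < n) _) => I S1 S2.
move: (dot _ _) (dot _ _) (h _) (n%:R * n.+1%:R) => d1 d2 u1 f1; lra.
Qed.

End Trace.

(** One infinite run serves every N, so that the first accurate N can be picked afterwards. *)
Lemma diag_trace_exists z0 : Y z0 -> exists x y z c,
  forall N, diag_trace true h (3 * L) L Y x0 z0 N x y z c.
Proof.
move=> Yz0.
have /choice[F HF] : forall kw : nat * 'rV[R]_q, exists oc, Y kw.2 ->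
    imp_step true h (3 * L) L Y x0 kw.2 (estep kw.1.+1) oc.1 oc.2.
  move=> [k w]; have [Yw|nY] := pselect (Y w); last by exists ((0, 0), 0%N).
  by have [out [cost H]] := imp_step_exists (estep_gt0 k) Yw; exists (out, cost).
pose st := fix st k : 'rV[R]_p * 'rV[R]_q * 'rV[R]_q := if k is k'.+1 then
    let w := mix k' (st k').1.2 (st k').2 in let o := (F (k', w)).1 in
    (o, proj Y ((st k').2 + eta k' *: grady h o.1 w))
  else (x0, z0, z0).
have Yst k : Y (st k).1.2 /\ Y (st k).2.
  elim: k => [//|k [Yy Yz]]; have Yw := mix_mem k Yy Yz.
  have [? _ _] := imp_step_spec (estep_gt0 k) Yw (HF (k, _) Yw); split => //=.
  by have [] := projP kY ((st k).2 + eta k *: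
    grady h (F (k, mix k (st k).1.2 (st k).2)).1.1 (mix k (st k).1.2 (st k).2)) Yw.
exists (fun k => (st k).1.1), (fun k => (st k).1.2), (fun k => (st k).2).
exists (fun k => (F (k, mix k (st k).1.2 (st k).2)).2) => N; split => // k _.
split => //=; have [Yy Yz] := Yst k.
by have := HF (k, mix k (st k).1.2 (st k).2) (mix_mem k Yy Yz); rewrite -surjective_pairing.
Qed.

Lemma diag_trace_cost z0 N x y z c Rm T : Y z0 ->
  diag_trace true h (3 * L) L Y x0 z0 N x y z c ->
  (forall k, (k < N)%N -> 2 * B ^+ 2 / L <= eagd_of (estep k.+1) * 2 ^+ T) ->
  (forall k, (k < N)%N -> (nR_of (estep k.+1) <= Rm)%N) ->
  (\sum_(k < N) (c k).+1 <= N * (Rm.+1 * T.+1).+1)%N.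
Proof.
move=> Yz0 tr HT HR; rewrite -[X in (_ <= X * _)%N]card_ord -sum_nat_const.
apply: leq_sum => -[k kN] _ /=; rewrite ltnS.
have [Yy Yz] := diag_trace_mem Yz0 tr (ltnW kN).
have [_ _ _ H] := tr; have [Himp _] := H k kN.
apply: leq_trans (imp_step_cost (mix_mem k Yy Yz) Himp (HT k kN)) _.
by rewrite leq_mul2r ltnS HR// orbT.
Qed.

End ImpStep.

(** * Proximal steps and the outer loop *)

Section ProxDiag.
Context {R : realType} {p q : nat}.
Variables (L : R) (Y : set 'rV[R]_q) (g : 'rV[R]_p * 'rV[R]_q -> R) (y0 : 'rV[R]_q).
Hypotheses (L0 : 0 < L) (Yy0 : Y y0) (cY : convex_set Y) (kY : compact Y)
  (sg : smooth L Y g)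
  (cg : forall x, convex_function Y (fun y => - g (x, y))).

Local Notation D := (diam Y).
Local Notation f := (maxy g Y).

Section Step.
Variable xk : 'rV[R]_p.

Definition proxg (z : 'rV[R]_p * 'rV[R]_q) : R := g z + L * enorm (z.1 - xk) ^+ 2.
Local Notation h := proxg.

Lemma proxg_bounds x y d : Y y ->
  L / 2 * dot d d <=
    h (x + d, y) - h (x, y) - dot (gradx g x y + (2 * L) *: (x - xk)) d
  <= 3 * L / 2 * dot d d.
Proof.
move=> Yy; have := smooth_descentx sg x d Yy; rewrite ler_norml => /andP[h1 h2].
rewrite /proxg /= !sqr_enorm (_ : x + d - xk = (x - xk) + d); last by rewrite addrAC.
move: (x - xk) h1 h2 => e; rewrite !dotE (dotC d e); move: (g _) (g _) => g1 g2.
move: (dot _ _) (dot _ _) (dot _ _) (dot _ _) => u1 u2 u3 u4 h1 h2.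
by apply/andP; split; lra.
Qed.

Lemma gradx_proxg x y : Y y -> gradx h x y = gradx g x y + (2 * L) *: (x - xk).
Proof.
move=> Yy; have [] := @quadratic_grad _ _ (fun u => h (u, y)) x
  (gradx g x y + (2 * L) *: (x - xk)) (3 * L / 2) => // d.
have /andP[h1 h2] := proxg_bounds x d Yy; rewrite ler_norml h2 andbT.
apply: le_trans h1; have d0 := mulr_ge0 (ltW L0) (dot_ge0 d); lra.
Qed.

Lemma grady_proxg x y : grady h x y = grady g x y.
Proof.
apply/rowP => i; rewrite !mxE /derive.
have -> // : (fun t : R => t^-1 *: (((fun v => h (x, v)) \o shift y)
    (t *: delta_mx 0 i) - h (x, y)) : R^o) =
  (fun t : R => t^-1 *: (((fun v => g (x, v)) \o shift y)
    (t *: delta_mx 0 i) - g (x, y))).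
by apply/funext => t /=; rewrite /proxg /= opprD addrACA subrr addr0.
Qed.

Lemma proxg_low x x' y : Y y ->
  h (x, y) + dot (gradx h x y) (x' - x) + L / 2 * dot (x' - x) (x' - x) <= h (x', y).
Proof.
move=> Yy; rewrite gradx_proxg//; have /andP[+ _] := proxg_bounds x (x' - x) Yy.
rewrite [x + (x' - x)]addrC subrK; move: (h _) (h _) (dot _ _) (dot _ _) => a b u v; lra.
Qed.

Lemma proxg_up x x' y : Y y ->
  h (x', y) <= h (x, y) + dot (gradx h x y) (x' - x) + 3 * L / 2 * dot (x' - x) (x' - x).
Proof.
move=> Yy; rewrite gradx_proxg//; have /andP[_] := proxg_bounds x (x' - x) Yy.
rewrite [x + (x' - x)]addrC subrK; move: (h _) (h _) (dot _ _) (dot _ _) => a b u v; lra.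
Qed.

Lemma proxg_xy x y y' : Y y -> Y y' ->
  enorm (gradx h x y - gradx h x y') <= L * enorm (y - y').
Proof.
move=> Yy Yy'; rewrite !gradx_proxg// opprD addrACA subrr addr0.
by have := smooth_gradx sg x x Yy Yy'; rewrite subrr enorm0 add0r.
Qed.

Lemma proxg_yx x x' w : Y w ->
  enorm (grady h x w - grady h x' w) <= L * enorm (x - x').
Proof.
move=> Yw; rewrite !grady_proxg.
by have := smooth_grady sg x x' Yw Yw; rewrite subrr enorm0 addr0.
Qed.

Lemma proxg_conc x y y' : Y y -> Y y' ->
  h (x, y') <= h (x, y) + dot (grady h x y) (y' - y).
Proof.
move=> Yy Yy'; rewrite grady_proxg /proxg /=.
have := concave_grady L0 cY sg (cg x) Yy Yy'.
move: (g _) (g _) (dot _ _) (enorm _ ^+ 2) => a b u r; lra.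
Qed.

Lemma proxg_ylow x y y' : Y y -> Y y' ->
  h (x, y) + dot (grady h x y) (y' - y) - L / 2 * dot (y' - y) (y' - y) <= h (x, y').
Proof.
move=> Yy Yy'; rewrite grady_proxg /proxg /=.
have := smooth_descenty cY sg x Yy Yy'; rewrite ler_norml => /andP[+ _].
move: (g _) (g _) (dot _ _) (dot _ _) (enorm _ ^+ 2) => a b u v r; lra.
Qed.

Lemma maxy_proxg u : maxy h Y u = proxf L Y g xk u.
Proof. by rewrite /proxf -sqr_enorm -(maxyD L0 Yy0 cY kY sg cg). Qed.

Lemma gradx_proxg_center y : Y y -> gradx h xk y = gradx g xk y.
Proof. by move=> Yy; rewrite gradx_proxg// subrr scaler0 addr0. Qed.

Variable fstar : R.
Hypothesis fs : forall x, fstar <= f x.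

Lemma inf_maxy_proxg :
  inf [set maxy h Y u | u in setT] = inf [set proxf L Y g xk u | u in setT].
Proof. by congr inf; apply: eq_imagel => u _; exact: maxy_proxg. Qed.

Lemma prox_step_gap b et xk1 c : prox_step b g L Y et y0 xk xk1 c ->
  f xk1 + L * enorm (xk1 - xk) ^+ 2 <= inf [set proxf L Y g xk u | u in setT] + et / 4.
Proof. by move=> [N [x [y [z [c' [_ [[_ +] _] -> _]]]]]]; rewrite inf_maxy_proxg. Qed.

Hypothesis D0 : 0 < D.

Local Notation accurate x et := (fun n : nat => (0 < n)%N /\
  f (diag_avg x n) + L * enorm (diag_avg x n - xk) ^+ 2 <=
    inf [set maxy h Y u | u in setT] + et / 4).

(** Bounding h(u, v) by the maximum over y, for every u, turns the gap of [diag_gap] into a bound by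
    the min-max value. *)
Lemma diag_accurate b et N x y z c n :
  diag_trace b h (3 * L) L Y xk y0 N x y z c -> (0 < n <= N)%N ->
  54 * L * D ^+ 2 / (n%:R * n.+1%:R) <= et / 4 -> accurate x et n.
Proof.
move=> tr nN Het; split; first by case/andP: nN.
have [v Yv H] := diag_gap L0 cY kY D0 proxg_low proxg_up proxg_xy proxg_yx
  proxg_conc proxg_ylow Yy0 tr nN.
rewrite inf_maxy_proxg sqr_enorm -/(proxf L Y g xk (diag_avg x n)) -maxy_proxg -lerBlDr.
apply: lb_le_inf; first by exists (proxf L Y g xk xk), xk.
move=> _ [u _ <-]; rewrite lerBlDr; apply: (maxy_le Yy0) => y' Yy'.
apply: le_trans (H u y' Yy') _; apply: lerD => //.
by rewrite /proxf -sqr_enorm lerD2r; exact: (le_maxy L0 Yy0 cY kY sg cg).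
Qed.

Lemma prox_step_exists et : 0 < et -> exists xk1 c, prox_step true g L Y et y0 xk xk1 c.
Proof.
move=> et0.
have HB y : Y y ->
    enorm (gradx h xk y) <= 2 * (L * D) + Num.sqrt (2 * L * (f xk - fstar)).
  by move=> Yy; rewrite gradx_proxg_center//; exact: (gradx_bound L0 Yy0 cY kY sg cg).
have [x [y [z [c H]]]] := diag_trace_exists L0 cY kY D0 proxg_low proxg_up proxg_xy
  proxg_yx HB Yy0.
have [|N HN] := @stops_at_exists (accurate x et).
  pose n := (natceil (216 * L * D ^+ 2 / et)).+1.
  exists n; apply: (diag_accurate (H n)); first by rewrite leqnn.
  rewrite ler_pdivrMr ?mulr_gt0//.
  have h1 := le_natceil (216 * L * D ^+ 2 / et); rewrite ler_pdivrMr// in h1.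
  have h2 : (natceil (216 * L * D ^+ 2 / et))%:R <= n%:R * n.+1%:R :> R.
    by rewrite -natrM ler_nat (leq_trans (leqnSn _))// leq_pmulr.
  have := ler_wpM2r (ltW et0) h2; lra.
exists (diag_avg x N), (\sum_(k < N) (c k).+1)%N, N, x, y, z, c; split => //.
Qed.

Local Notation estep k :=
  ((3 * L) ^+ 2 * D ^+ 2 / (L * (k%N)%:R ^+ 3 * (k%N).+1%:R) : R).

(** Had the run lasted more than n iterations, the average after n would already have been accurate,
    against promptness. *)
Lemma prox_step_cost et xk1 c B n T Rm : prox_step true g L Y et y0 xk xk1 c ->
  (0 < n)%N -> 54 * L * D ^+ 2 / (n%:R * n.+1%:R) <= et / 4 ->
  (forall y, Y y -> enorm (gradx g xk y) <= B) ->
  (forall k, (k < n)%N -> 2 * B ^+ 2 / L <= eagd_of L (estep k.+1) * 2 ^+ T) ->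
  (forall k, (k < n)%N -> (nR_of L Y (estep k.+1) <= Rm)%N) ->
  (c <= n * (Rm.+1 * T.+1).+1)%N.
Proof.
move=> [N [x [y [z [c' [tr HN _ ->]]]]]] n0 Het HB HT HR.
have Nn : (N <= n)%N.
  rewrite leqNgt; apply/negP => nN.
  have nN' : (0 < n <= N)%N by rewrite n0 ltnW.
  by have := stops_at_le HN (diag_accurate tr nN' Het); rewrite leqNgt nN.
have HB' y' : Y y' -> enorm (gradx h xk y') <= B.
  by move=> Yy'; rewrite gradx_proxg_center//; exact: HB.
apply: leq_trans (diag_trace_cost L0 cY kY D0 proxg_low proxg_up proxg_xy proxg_yx
  HB' Yy0 tr _ _) _.
- by move=> k kN; apply: HT; exact: leq_trans Nn.
- by move=> k kN; apply: HR; exact: leq_trans Nn.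
by rewrite leq_mul2r Nn orbT.
Qed.

End Step.

Variable fstar : R.
Hypothesis fs : forall x, fstar <= f x.
Variable et : R.
Hypothesis et0 : 0 < et.

Lemma prox_continue_decrease x x' :
  ~ (f x - 3 * et / 4 <= f x' + L * enorm (x' - x) ^+ 2) -> f x' < f x - 3 * et / 4.
Proof.
move/negP; rewrite -ltNge; apply: le_lt_trans.
by rewrite lerDl mulr_ge0 ?sqr_ge0// ltW.
Qed.

(** A continued iteration lowers f by more than 3 et / 4, which keeps the hypothesis with one
    iteration fewer; an exhausted loop would put f x below fstar. *)
Lemma prox_loop_returns b n x o c : prox_loop b g L Y et y0 n x o c ->
  f x - fstar < n%:R * (3 * et / 4) ->
  exists2 x', o = Some x' & f x' <= inf [set proxf L Y g x' u | u in setT] + et.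
Proof.
elim=> {n x o c} [x|n x x' c step ret _|n x x' c o c' _ cont _ IH H].
- by rewrite mul0r ltNge subr_ge0 fs.
(* The slack et is 3 et / 4 from the stopping test plus et / 4 from the inexact proximal step. *)
- exists x => //; have := prox_step_gap step; lra.
- apply: IH; have := prox_continue_decrease cont.
  by move: H; rewrite -addn1 natrD; lra.
Qed.

Hypothesis D0 : 0 < D.

Lemma prox_loop_exists n x : exists o c, prox_loop true g L Y et y0 n x o c.
Proof.
elim: n x => [|n IH] x; first by exists None, 0%N; exact: prox_exhausted.
have [x' [c step]] := prox_step_exists x fs D0 et0.
have [ret|cont] := pselect (f x - 3 * et / 4 <= f x' + L * enorm (x' - x) ^+ 2).
  by exists (Some x), c; exact: (prox_return _ step).
have [out [c' H]] := IH x'.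
by exists out, (c + c')%N; exact: (prox_continue step).
Qed.

Lemma prox_loop_cost M F0 n x o c :
  (forall x x' c, f x <= F0 -> prox_step true g L Y et y0 x x' c -> (c <= M)%N) ->
  prox_loop true g L Y et y0 n x o c -> f x <= F0 -> (c <= n * M)%N.
Proof.
move=> HM; elim=> {n x o c} [//|n x x' c step ret xF|n x x' c o c' step cont _ IH xF].
  by rewrite mulSn (leq_trans (HM _ _ _ xF step))// leq_addr.
rewrite mulSn leq_add//; first exact: HM step.
apply: IH; have := prox_continue_decrease cont; have := et0; lra.
Qed.

End ProxDiag.

(** * Inner iteration counts in terms of E = 1/eps *)

Section Asymptotics.
Context {R : realType}.
Implicit Types (E a b : R).

Lemma natceil_le a b : 0 <= a -> a <= b -> (natceil a <= natceil b)%N.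
Proof.
move=> a0 ab; rewrite -ltnS -(ltr_nat R) -addn1 natrD.
have := natceil_lt a0; have := le_natceil b; lra.
Qed.

Lemma ln2_ge_half : 2^-1 <= ln (2 : R).
Proof.
have := @le_ln1Dx R (- 2^-1); have -> : 1 + - 2^-1 = (2^-1 : R) by field.
by rewrite lnV ?posrE//; lra.
Qed.

Lemma ln_ge1 E : 9 <= E -> 1 <= ln E.
Proof.
move=> E9; apply: le_trans (_ : ln (2 ^+ 2) <= _).
  by rewrite lnXn// mulr2n; have := ln2_ge_half; lra.
by rewrite ler_ln ?posrE ?exprn_gt0//; lra.
Qed.

Variables (L : R) (q : nat) (Y : set 'rV[R]_q).
Hypotheses (L0 : 0 < L) (D0 : 0 < diam Y).
Local Notation D := (diam Y).
Local Notation estep k :=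
  ((3 * L) ^+ 2 * D ^+ 2 / (L * k%:R ^+ 3 * k.+1%:R) : R).

Lemma emp_of_estep k :
  75 * k.+1%:R ^+ 3 * k.+2%:R * emp_of L (estep k.+1) ^+ 2 = 8 * D ^+ 2.
Proof.
have := emp_of_sqr L0 (estep_gt0 L0 D0 k).
have : (0 : R) < k.+1%:R by []. have : (0 : R) < k.+2%:R by [].
move: (k.+1%:R : R) (k.+2%:R : R) (emp_of _ _) => a b m b0 a0 H.
have /(congr1 (fun z => z * a ^+ 3 * b / (9 * L))) := H.
have -> : 675 * L * m ^+ 2 * a ^+ 3 * b / (9 * L) = 75 * a ^+ 3 * b * m ^+ 2.
  by field; rewrite gt_eqF.
move=> ->; field.
by rewrite !gt_eqF.
Qed.

Lemma estep_index_bound E n k : n%:R <= E ^+ 2 -> (k < n)%N ->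
  1 <= (k.+1%:R : R) /\ (k.+1%:R : R) ^+ 3 * k.+2%:R <= 2 * E ^+ 8.
Proof.
move=> nE kn; split; first by rewrite ler1n.
have kE : (k.+1%:R : R) <= E ^+ 2 by apply: le_trans nE; rewrite ler_nat.
have k2 : (k.+2%:R : R) <= 2 * E ^+ 2.
  by have : (1 : R) <= k.+1%:R by [rewrite ler1n]; rewrite -[k.+2]addn1 natrD; lra.
have -> : 2 * E ^+ 8 = (E ^+ 2) ^+ 3 * (2 * E ^+ 2) by ring.
by apply: ler_pM => //; rewrite lerXn2r ?nnegrE// sqr_ge0.
Qed.

(** L and D cancel: (2 D / emp)^2 = 75/2 (k + 1)^3 (k + 2) <= 75 E^8 <= E^10, since E^2 >= 81. The
    base-2 logarithm is then at most 5 ln E / ln 2 <= 10 ln E. *)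
Lemma nR_of_bound E n k : 9 <= E -> n%:R <= E ^+ 2 -> (k < n)%N ->
  (nR_of L Y (estep k.+1) <= natceil (10 * ln E))%N.
Proof.
move=> E9 nE kn; have [k1 kE] := estep_index_bound nE kn.
have m0 := emp_of_gt0 L0 (estep_gt0 L0 D0 k); have Em := emp_of_estep k.
rewrite /nR_of; move: (emp_of _ _) m0 Em => m m0 Em.
have k2 : (1 : R) <= k.+2%:R by rewrite ler1n.
set x := 2 * D / m.
have x0 : 0 < x by rewrite divr_gt0// mulr_gt0.
have D2 : 0 < D ^+ 2 by rewrite exprn_gt0.
have xx : 2 * x ^+ 2 = 75 * (k.+1%:R ^+ 3 * k.+2%:R).
  apply: (mulIf (lt0r_neq0 D2)).
  have -> : 2 * x ^+ 2 * D ^+ 2 = x ^+ 2 * (8 * D ^+ 2) / 4 by field.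
  by rewrite -Em /x; field; rewrite gt_eqF.
have kk1 : 1 <= (k.+1%:R : R) ^+ 3 * k.+2%:R.
  by rewrite mulr_ege1// exprn_ege1.
have x1 : 1 <= x by rewrite -ler_sqr ?nnegrE ?(ltW x0)//; lra.
have E0 : 0 < E by lra.
have xE : x <= E ^+ 5.
  rewrite -ler_sqr ?nnegrE ?(ltW x0) ?exprn_ge0 ?(ltW E0)//.
  have -> : (E ^+ 5) ^+ 2 = E ^+ 2 * E ^+ 8 by ring.
  have E80 : 0 <= E ^+ 8 by rewrite exprn_ge0// ltW.
  have : 75 * E ^+ 8 <= E ^+ 2 * E ^+ 8.
    by rewrite ler_wpM2r//; apply: le_trans (_ : 9 ^+ 2 <= _); [lra|rewrite lerXn2r ?nnegrE//; lra].
  lra.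
have ln2 := @ln2_gt0 R.
apply: natceil_le; first by apply: divr_ge0; [exact: ln_ge0|exact: ltW].
rewrite ler_pdivrMr//; apply: le_trans (_ : ln (E ^+ 5) <= _).
  by rewrite ler_ln ?posrE// exprn_gt0.
rewrite lnXn// -[_ *+ 5]mulr_natl -mulrA; have := ln_ge1 E9; have := ln2_ge_half.
move: (ln 2) (ln E) => u v u2 v1; nra.
Qed.

(** eagd is at least of order L D^2 / E^8; the data survive only in B^2 / (L D)^2, which one more
    factor E absorbs, hence E^9. *)
Lemma eagd_of_bound E n k B T : 9 <= E -> n%:R <= E ^+ 2 -> (k < n)%N ->
  100 / 3 * (B ^+ 2 / (L ^+ 2 * D ^+ 2)) <= E -> E ^+ 9 <= 2 ^+ T ->
  2 * B ^+ 2 / L <= eagd_of L (estep k.+1) * 2 ^+ T.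
Proof.
move=> E9 nE kn BE ET; have [k1 kE] := estep_index_bound nE kn.
have Em := emp_of_estep k; rewrite (eagd_ofE L0).
move: (emp_of _ _) Em => m Em.
have kk0 : 0 < (k.+1%:R : R) ^+ 3 * k.+2%:R by rewrite mulr_gt0// exprn_gt0.
have kk75 : 0 < 75 * ((k.+1%:R : R) ^+ 3 * k.+2%:R) by rewrite mulr_gt0.
rewrite -(ler_pM2l kk75).
have -> : 75 * (k.+1%:R ^+ 3 * k.+2%:R) * (9 / 8 * L * m ^+ 2 * 2 ^+ T)
    = 9 * L * D ^+ 2 * 2 ^+ T.
  have -> : 75 * (k.+1%:R ^+ 3 * k.+2%:R) * (9 / 8 * L * m ^+ 2 * 2 ^+ T)
    = 9 / 8 * L * (75 * k.+1%:R ^+ 3 * k.+2%:R * m ^+ 2) * 2 ^+ T by ring.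
  by rewrite Em; field.
have B0 : 0 <= 2 * B ^+ 2 / L by rewrite divr_ge0 ?(ltW L0)// mulr_ge0 ?sqr_ge0.
have E80 : 0 <= E ^+ 8 by rewrite exprn_ge0//; lra.
have LD0 : 0 < 9 * L * D ^+ 2 by rewrite !mulr_gt0 ?exprn_gt0.
apply: le_trans (_ : 75 * (2 * E ^+ 8) * (2 * B ^+ 2 / L) <= _).
  by rewrite ler_wpM2r// ler_pM2l.
apply: le_trans (_ : 9 * L * D ^+ 2 * (E * E ^+ 8) <= _).
  have -> : 75 * (2 * E ^+ 8) * (2 * B ^+ 2 / L) =
      9 * L * D ^+ 2 * (100 / 3 * (B ^+ 2 / (L ^+ 2 * D ^+ 2)) * E ^+ 8).
    by field; rewrite !gt_eqF.
  by rewrite ler_pM2l// ler_wpM2r.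
by rewrite ler_pM2l// -exprS.
Qed.

Lemma expn2_natceil_ln E : 9 <= E ->
  E ^+ 9 <= 2 ^+ natceil (18 * ln E).
Proof.
move=> E9; have E0 : 0 < E ^+ 9 by rewrite exprn_gt0//; lra.
apply: le_trans (le_expn2_natceil E0) _.
have ln2 := @ln2_gt0 R; have l1 := ln_ge1 E9.
apply: ler_weXn2l; first by rewrite ler1n.
rewrite lnXn; last by lra.
rewrite -[_ *+ 9]mulr_natl; apply: natceil_le.
  by apply: divr_ge0; [apply: mulr_ge0 => //; lra|exact: ltW].
rewrite ler_pdivrMr// -mulrA; have := ln2_ge_half.
move: (ln 2) (ln E) ln2 l1 => u v u0 v1 u2; nra.
Qed.

End Asymptotics.

(** 119 = 118 + 1 and 88 > 256/3 + 2/9 absorb the roundings; 241 = 180 + 56 + 5 sums the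
    coefficients of (10 l + 2)(18 l + 2) + 1, each power of l being at most l^2. *)
Lemma complexity_count {R : realType} (L D Dl E l : R) (n K M : nat) :
  0 < L -> 0 < D -> 0 < Dl -> 9 <= E -> 1 <= l ->
  1 <= E * (L * D) -> 1 <= E * (L * Dl) ->
  n%:R <= 118 * (L * D) * E + 1 ->
  K%:R <= 256 / 3 * (L * Dl) * E ^+ 2 + 1 ->
  M%:R <= (10 * l + 2) * (18 * l + 2) + 1 ->
  (K.+1 * (n * M))%:R <= 88 * 119 * 241 * (L ^+ 2 * D * Dl * E ^+ 3 * l ^+ 2).
Proof.
move=> L0 D0 Dl0 E9 l1 LDE LDlE nE KE ME.
have nB : n%:R <= 119 * (L * D * E) by lra.
have KB : K.+1%:R <= 88 * (L * Dl * E ^+ 2).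
  have : 9 * 1 <= E * (E * (L * Dl)) by rewrite ler_pM//; lra.
  by rewrite -addn1 natrD; lra.
have MB : M%:R <= 241 * l ^+ 2.
  have : 1 * 1 <= l * l by rewrite ler_pM.
  have : l * 1 <= l * l by rewrite ler_pM2l//; lra.
  lra.
rewrite !natrM; apply: le_trans (_ : 88 * (L * Dl * E ^+ 2) *
  (119 * (L * D * E) * (241 * l ^+ 2)) <= _).
  by apply: ler_pM => //; exact: ler_pM.
by rewrite le_eqVlt; apply/orP; left; apply/eqP; ring.
Qed.

Theorem theorem2 (R : realType) :
  exists2 C : R, 0 < C &
  forall (p q : nat) (L fstar : R) (g : 'rV[R]_p * 'rV[R]_q -> R)
         (Y : set 'rV[R]_q) (x0 : 'rV[R]_p) (y0 : 'rV[R]_q),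
  0 < L ->
  Y y0 ->
  convex_set Y ->
  compact Y ->
  smooth L Y g ->
  (forall x, convex_function Y (fun y => - g (x, y))) ->
  (forall x, fstar <= maxy g Y x) ->
  let f := maxy g Y in
  let K (eps : R) := natceil (4 ^+ 4 * L * (f x0 - fstar) / (3 * eps ^+ 2)) in
  (forall eps : R, 0 < eps ->
     (forall (prompt : bool) (out : option 'rV[R]_p) (cost : nat),
        prox_diag prompt g L Y eps x0 y0 (K eps) out cost ->
        exists2 x, out = Some x & is_FOSP L f eps x) /\
     (0 < diam Y -> exists (out : option 'rV[R]_p) (cost : nat),
        prox_diag true g L Y eps x0 y0 (K eps) out cost)) /\
  (0 < diam Y -> fstar < f x0 ->
     exists2 eps0 : R, 0 < eps0 &
     forall eps : R, 0 < eps -> eps < eps0 ->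
     forall (out : option 'rV[R]_p) (cost : nat),
       prox_diag true g L Y eps x0 y0 (K eps) out cost ->
       cost%:R <= C * (L ^+ 2 * diam Y * (f x0 - fstar) / eps ^+ 3
                       * ln (1 / eps) ^+ 2)).
Proof.
exists (88 * 119 * 241); first by apply: mulr_gt0; [apply: mulr_gt0|]; rewrite ltr0n.
move=> p q L fstar g Y x0 y0 L0 Yy0 cY kY sg cg fs f K.
have Delta0 : 0 <= f x0 - fstar by rewrite subr_ge0.
split.
  move=> eps eps0; have et0 : 0 < eps ^+ 2 / (64 * L).
    by rewrite divr_gt0 ?exprn_gt0// mulr_gt0.
  split; last by move=> D0; exact: (prox_loop_exists L0 Yy0 cY kY sg cg fs et0 D0).
  move=> b out cost run.
  have [|x -> gap] := prox_loop_returns L0 Yy0 cY kY sg cg fs run.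
    have e0 : 0 < 3 * (eps ^+ 2 / (64 * L)) / 4 by rewrite divr_gt0// mulr_gt0.
    (* K decreases of 3 et / 4 already cover f x0 - fstar; the loop runs K + 1 times, which makes
       the inequality strict. *)
    apply: le_lt_trans (_ : (K eps)%:R * (3 * (eps ^+ 2 / (64 * L)) / 4) < _).
      rewrite -ler_pdivrMr//; apply: le_trans (le_natceil _).
      rewrite le_eqVlt; apply/orP; left; apply/eqP; rewrite /f; field.
      by rewrite !gt_eqF.
    by rewrite ltr_pM2r// ltr_nat.
  exists x => //; apply: (is_FOSP_of_gap L0 Yy0 cY kY sg cg fs _ _ gap); first exact: ltW.
  have -> : 8 * L * (eps ^+ 2 / (64 * L)) = eps ^+ 2 / 8 by field; rewrite gt_eqF.
  by rewrite ler_pdivrMr// ler_peMr ?sqr_ge0// ler1n.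
move=> D0; rewrite -subr_gt0 => Dl0.
set D := diam Y in D0 *; set Dl := f x0 - fstar in Delta0 Dl0 *.
(* The value of [gradx_bound] on the sublevel set f <= f x0; [cB] is the constant that E must
   dominate in [eagd_of_bound]. *)
pose B := 2 * (L * D) + Num.sqrt (2 * L * Dl).
pose cB := 100 / 3 * (B ^+ 2 / (L ^+ 2 * D ^+ 2)).
have LD0 : 0 < L * D by rewrite mulr_gt0.
have LDl0 : 0 < L * Dl by rewrite mulr_gt0.
have cB0 : 0 <= cB.
  by apply: mulr_ge0 => //; apply: divr_ge0; [exact: sqr_ge0|rewrite mulr_ge0 ?sqr_ge0].
(* One threshold for everything required of E; the term 119 L D ensures n <= E^2. *)
pose S := 9 + (L * D)^-1 + 119 * (L * D) + cB + (L * Dl)^-1.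
have iLD : 0 < (L * D)^-1 by rewrite invr_gt0.
have iLDl : 0 < (L * Dl)^-1 by rewrite invr_gt0.
have S0 : 0 < S by rewrite /S; lra.
exists S^-1; first by rewrite invr_gt0.
move=> eps eps0 epsS out cost run.
pose E := eps^-1; have E0 : 0 < E by rewrite invr_gt0.
have SE : S < E by rewrite /E -(invrK S) ltf_pV2// posrE// invr_gt0.
have [E9 ELD ED EcB ELDl] : [/\ 9 <= E, (L * D)^-1 <= E, 119 * (L * D) <= E, cB <= E &
    (L * Dl)^-1 <= E].
  by move: SE; rewrite /S => SE; split; lra.
have {}ELD : 1 <= E * (L * D) by rewrite -ler_pdivrMr// mul1r.
have {}ELDl : 1 <= E * (L * Dl) by rewrite -ler_pdivrMr// mul1r.
have l1 := ln_ge1 E9; set l := ln E in l1.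
(* As et / 4 = eps^2 / (256 L), accuracy follows from n^2 >= 54 * 256 (L D E)^2, and 118 is the
   least integer whose square reaches 54 * 256. *)
pose n := natceil (118 * (L * D) * E).
have a0 : 0 < 118 * (L * D) * E by rewrite mulr_gt0// mulr_gt0.
have n1 := le_natceil (118 * (L * D) * E); rewrite -/n in n1.
have nE := ltW (natceil_lt (ltW a0)); rewrite -/n in nE.
have n0 : (0 < n)%N by rewrite -(ltr_nat R); exact: lt_le_trans n1.
have nE2 : n%:R <= E ^+ 2.
  apply: le_trans (_ : 119 * (L * D) * E <= _); first by move: ELD nE; lra.
  by rewrite expr2 ler_pM2r.
pose Rm := natceil (10 * l); pose T := natceil (18 * l).
have step_cost x x' c : f x <= f x0 ->
    prox_step true g L Y (eps ^+ 2 / (64 * L)) y0 x x' c -> (c <= n * (Rm.+1 * T.+1).+1)%N.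
  move=> fx step; apply: (prox_step_cost L0 Yy0 cY kY sg cg D0 step (B := B)) => //.
  - rewrite ler_pdivrMr; last by rewrite mulr_gt0// ltr0n.
    have n2 : (118 * (L * D) * E) ^+ 2 <= n%:R * n.+1%:R.
      rewrite expr2; apply: ler_pM; rewrite ?(ltW a0)//.
      by apply: le_trans n1 _; rewrite ler_nat.
    have e40 : 0 <= eps ^+ 2 / (64 * L) / 4.
      by rewrite divr_ge0// divr_ge0 ?sqr_ge0// mulr_ge0// ltW.
    apply: le_trans (ler_wpM2l e40 n2).
    have -> : eps ^+ 2 / (64 * L) / 4 * (118 * (L * D) * E) ^+ 2
        = 118 ^+ 2 / 256 * (L * D ^+ 2).
      by rewrite /E; field; rewrite !gt_eqF.
    have : 0 <= L * D ^+ 2 by rewrite mulr_ge0 ?sqr_ge0// ltW.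
    by rewrite -/D; lra.
  - move=> y Yy; apply: le_trans (gradx_bound L0 Yy0 cY kY sg cg x fs Yy) _.
    rewrite lerD2l ler_wsqrtr// ler_pM2l ?mulr_gt0//.
    by rewrite /Dl lerD2r.
  - move=> k kn; apply: (eagd_of_bound L0 D0 E9 nE2 kn EcB).
    exact: expn2_natceil_ln.
  - by move=> k kn; exact: (nR_of_bound L0 D0 E9 nE2 kn).
have et0 : 0 < eps ^+ 2 / (64 * L) by rewrite divr_gt0 ?exprn_gt0// mulr_gt0.
have C := prox_loop_cost L0 et0 step_cost run (lexx _).
have := complexity_count (K := K eps) (M := (Rm.+1 * T.+1).+1) L0 D0 Dl0 E9 l1 ELD ELDl nE.
have -> : L ^+ 2 * D * Dl * E ^+ 3 * l ^+ 2 = L ^+ 2 * D * Dl / eps ^+ 3 * ln (1 / eps) ^+ 2.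
  by rewrite /l /E div1r exprVn.
move=> H; apply: le_trans (H _ _); first by rewrite ler_nat.
  have k0 : 0 <= 4 ^+ 4 * L * (f x0 - fstar) / (3 * eps ^+ 2).
    apply: divr_ge0; last by rewrite mulr_ge0 ?sqr_ge0.
    by apply: mulr_ge0 => //; rewrite mulr_ge0 ?exprn_ge0 ?ltW.
  apply: le_trans (ltW (natceil_lt k0)) _; rewrite lerD2r.
  rewrite le_eqVlt; apply/orP; left; apply/eqP; rewrite /E /Dl; field.
  by rewrite gt_eqF.
have Rm1 : (natceil (10 * l))%:R < 10 * l + 1 by apply: natceil_lt; lra.
have T1 : (natceil (18 * l))%:R < 18 * l + 1 by apply: natceil_lt; lra.
rewrite -addn1 natrD natrM lerD2r; apply: ler_pM => //; rewrite -addn1 natrD /Rm /T; lra.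
Qed.
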